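(* Let $S$ be a monomial algebra over a field $k$; that is, $S$ is a $k$-subalgebra of a polynomial ring $R = k[x_1, \ldots, x_n]$ generated by a set of monomials (not necessarily finite, so $S$ is not necessarily Noetherian). Regard $S$ as an $\mathbb{N}$-graded ring with the standard grading inherited from $R$, in which $\deg(x_i)=1$ for each $i$. Then $$\dim_{\mathrm{gr}}(S) = \dim(S) = \operatorname{tr.deg}_k(S) = \operatorname{GKdim}_k(S) = d(S).$$
   Context: All rings are commutative with identity, and $\mathbb{N}$ contains $0$. Equivalently, a monomial algebra is a $k$-algebra of the form $k[M]=k[\{x^a\mid a\in M\}]$ with $M$ an additive submonoid of $\mathbb{N}^n$, where $x^a=x_1^{a_1}\cdots x_n^{a_n}$. Its degree-$j$ component $S_j$ is the $k$-span of the monomials of total degree $j$ lying in $S$; $S_0=k$. $\dim(S)$ is the Krull dimension of $S$. $\dim_{\mathrm{gr}}(S)$, the graded Krull dimension, is the supremum of the lengths $r$ of chains $\mathfrak{p}_0\subsetneq\mathfrak{p}_1\subsetneq\cdots\subsetneq\mathfrak{p}_r$ of homogeneous prime ideals of $S$. $\operatorname{tr.deg}_k(S)$ is the transcendence degree over $k$ of the fraction field of the domain $S$. Gelfand--Kirillov dimension: for a finite-dimensional $k$-subspace $V\subseteq S$, let $V^n$ be the $k$-span of all products of $n$ elements of $V$ and $d_V(n)=\dim_k(k+V+\cdots+V^n)$. Then $\operatorname{GKdim}_k(S)=\sup_V\limsup_{n\to\infty}\frac{\log d_V(n)}{\log n}$, the supremum being over all finite-dimensional $k$-subspaces $V$ of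 $S$. Hilbert--Serre dimension: with the Poincaré series $P_S(t)=\sum_{j\ge0}(\dim_kS_j)t^j$, $d(S)=\min\{d\in\mathbb{N}\mid\lim_{t\to1-0}(1-t)^dP_S(t)<\infty\}$, where $t\to1-0$ is the limit from the left and the condition means that the limit exists and is finite. *)

(* Defs.v *)
From mathcomp Require Import all_boot all_order all_algebra.
(* mpoly has to be imported before mathcomp-analysis: in the other order their
   notation levels clash. *)
From mathcomp Require Import mpoly.
From mathcomp Require Import boolp classical_sets reals ereal topology
  normedtype sequences exp.

Set Implicit Arguments.
Unset Strict Implicit.
Unset Printing Implicit Defensive.

Import Order.TTheory GRing.Theory Num.Theory.
Import numFieldNormedType.Exports.

Local Open Scope classical_set_scope.
Local Open Scope ring_scope.

(* Subrings, ideals, subspaces and subfields are represented as classical sets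
   of elements of an ambient structure.  All dimensions take values in \bar R,
   so that suprema and infima always exist; in particular the supremum of an
   unbounded family of natural numbers is +oo and an infimum over the empty set
   is +oo. *)

Section LinearAlgebra.
Variables (k : fieldType) (U : lmodType k).

Definition is_subspace (W : set U) : Prop := GRing.submod_closed (mem W).

Definition lin_span (X : set U) : set U := smallest is_subspace X.

Definition lin_indep d (e : d.-tuple U) : Prop :=
  forall c : 'I_d -> k, \sum_(i < d) c i *: tnth e i = 0 -> forall i, c i = 0.

Definition is_basis (W : set U) d (e : d.-tuple U) : Prop :=
  lin_indep e /\ lin_span [set` e] = W.

Definition fin_dim (W : set U) : Prop :=
  exists d (e : d.-tuple U), is_basis W e.

(* The number of elements of a basis of W; it is the junk value [point] when W
   is not finite-dimensional. *)
Definition vdim (W : set U) : nat :=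
  get [set d | exists e : d.-tuple U, is_basis W e].

End LinearAlgebra.

Section Primes.
Variable A : comNzRingType.

(* I is an ideal of the subring S of A. *)
Definition is_ideal (S I : set A) : Prop :=
  [/\ I `<=` S, I 0, (forall x y, I x -> I y -> I (x + y))
    & (forall a x, S a -> I x -> I (a * x))].

Definition is_prime_ideal (S P : set A) : Prop :=
  [/\ is_ideal S P, ~ P 1
    & forall a b, S a -> S b -> P (a * b) -> P a \/ P b].

(* The supremum of the lengths r of the chains
   p 0 `<` p 1 `<` ... `<` p r of members of C. *)
Definition chain_dim (R : realType) (C : set (set A)) : \bar R :=
  ereal_sup [set r%:R%:E | r in [set r : nat | exists p : nat -> set A,
    (forall i, (i <= r)%N -> C (p i)) /\
    (forall i, (i < r)%N -> p i `<` p i.+1)]].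

Definition krull_dim (R : realType) (S : set A) : \bar R :=
  chain_dim R (is_prime_ideal S).

End Primes.

Section MonomialAlgebra.
Variables (k : fieldType) (n : nat).
Implicit Types (S I V : set {mpoly k[n]}).

Definition is_subalgebra S : Prop := GRing.subalg_closed (mem S).

Definition monomial_algebra S : Prop :=
  exists A : set 'X_{1..n}, S = smallest is_subalgebra [set 'X_[a] | a in A].

(* [pihomog mdeg d f] is the component of total degree d of f. *)
Definition is_homogeneous I : Prop :=
  forall f, I f -> forall d, I (pihomog mdeg d f).

Definition gr_krull_dim (R : realType) S : \bar R :=
  chain_dim R [set P | is_prime_ideal S P /\ is_homogeneous P].

(* The fraction field of S, as a subfield of that of k[x_1, ..., x_n]. *)
Definition fraction_field S : set {fraction {mpoly k[n]}} :=
  [set x | exists a b, [/\ S a, S b, b != 0 & x = tofrac a / tofrac b]].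

Definition alg_indep r (t : r.-tuple {fraction {mpoly k[n]}}) : Prop :=
  forall p : {mpoly k[r]},
    mmap (fun c : k => tofrac (c%:MP_[n])) (tnth t) p = 0 -> p = 0.

Definition trdeg (R : realType) S : \bar R :=
  ereal_sup [set r%:R%:E | r in
    [set r : nat | exists t : r.-tuple {fraction {mpoly k[n]}},
       [set` t] `<=` fraction_field S /\ alg_indep t]].

Definition space_exp V (m : nat) : set {mpoly k[n]} :=
  lin_span [set f | exists v : 'I_m -> {mpoly k[n]},
    (forall i, V (v i)) /\ f = \prod_(i < m) v i].

(* dim_k (k + V + ... + V ^ m); the summand k is [space_exp V 0]. *)
Definition growth V (m : nat) : nat :=
  vdim (lin_span (\bigcup_(i in [set i | (i <= m)%N]) space_exp V i)).

Definition GKdim (R : realType) S : \bar R :=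
  ereal_sup [set limn_esup (fun m => (ln (growth V m)%:R / ln (m%:R : R))%:E)
            | V in [set V | fin_dim V /\ V `<=` S]].

Definition graded_piece S (j : nat) : set {mpoly k[n]} :=
  lin_span [set 'X_[a] | a in [set a : 'X_{1..n} | mdeg a = j /\ S 'X_[a]]].

(* For 0 <= t < 1 the series converges, because dim_k S_j is bounded by a
   polynomial in j. *)
Definition poincare_series (R : realType) S (t : R) : R :=
  limn (pseries (fun j => (vdim (graded_piece S j))%:R) t).

(* Infimum in \bar R of a set of natural numbers: the minimum if the set is
   nonempty, +oo otherwise. *)
Definition hilbert_serre_dim (R : realType) S : \bar R :=
  ereal_inf [set d%:R%:E | d in [set d : nat |
    cvg ((fun t : R => (1 - t) ^+ d * poincare_series S t) t @[t --> 1^'-])]].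

End MonomialAlgebra.

(* Main.v *)
From HB Require Import structures.
Require Import Defs.
From mathcomp Require Import all_boot all_order all_algebra.
From mathcomp Require Import zify.
From mathcomp Require Import mpoly.
From mathcomp Require Import boolp classical_sets reals ereal topology
  normedtype sequences realfun exp.

(** Attach to an exponent [a] its generalized coordinates: the total degree,
then [a_1, ..., a_n].  Call a coordinate a pivot of the monoid [M] of exponents
if two elements of [M] agree in all earlier coordinates and differ in this one,
and let [r] be the number of pivots; it is the rank of the group generated by
[M], and every dimension equals [r].  An element of [M] is determined by its
pivot coordinates, so [M] has at most [(D + 1) ^ r] elements of degree at most
[D]; this bounds the transcendence degree, the Gelfand-Kirillov dimension and
the Poincare series from above.  Forgetting the coordinates one at a time gives
homogeneous primes whose inclusions are strict at the pivots, and elements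
witnessing the strict inclusions of a chain of primes are algebraically
independent.  Finally, combinations of the pivot pairs show that [M] contains
[q ^ r] disjoint translates of [q M] by exponents of degree [O(q)], whenever [q]
is prime to the differences of the pivot pairs; this self-similarity forces
[(1 - t) ^ r P_S(t)] to have a positive limit at [1]. *)

Set Implicit Arguments.
Unset Strict Implicit.
Unset Printing Implicit Defensive.

Import Order.TTheory GRing.Theory Num.Theory.
Import numFieldNormedType.Exports.

Local Open Scope classical_set_scope.
Local Open Scope ring_scope.

(** * Exponents and pivots *)

Section Span.
Variables (k : fieldType) (U : lmodType k).
Implicit Types W X : set U.

Lemma subspaceP W :
  is_subspace W <-> W 0 /\ forall c x y, W x -> W y -> W (c *: x + y).
Proof.
split=> [[W0 WL]|[W0 WL]]; split.
- by move: W0; rewrite inE.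
- by move=> c x y Wx Wy; have := WL c x y; rewrite !inE; apply.
- by rewrite inE.
- by move=> c x y; rewrite !inE; exact: WL.
Qed.

Lemma subspace_sum W (I : Type) (r : seq I) (P : pred I) (c : I -> k)
    (f : I -> U) :
  is_subspace W -> (forall i, P i -> W (f i)) ->
  W (\sum_(i <- r | P i) c i *: f i).
Proof.
case/subspaceP=> W0 WL Wf; elim: r => [|i r IH]; first by rewrite big_nil.
by rewrite big_cons; case: ifP => // Pi; apply: WL => //; apply: Wf.
Qed.

Lemma lin_span_subspace X : is_subspace (lin_span X).
Proof.
apply/subspaceP; split=> [W [] /subspaceP[]//|c x y Xx Xy W [sW XW]].
by have /subspaceP[_ WL] := sW; apply: WL; [apply: Xx|apply: Xy].
Qed.

Lemma sub_lin_span X : X `<=` lin_span X.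
Proof. by move=> x Xx W [_]; apply. Qed.

Lemma lin_span_min X W : is_subspace W -> X `<=` W -> lin_span X `<=` W.
Proof. by move=> sW XW x; apply. Qed.

End Span.

Section Exponents.
Variables (k : fieldType) (n : nat).
Implicit Types (S : set {mpoly k[n]}) (E : set 'X_{1..n}) (a b : 'X_{1..n}).

Definition msupported E : set {mpoly k[n]} :=
  [set f | forall m, m \in msupp f -> E m].

Definition expo S : set 'X_{1..n} := [set a | S 'X_[a]].

Lemma msupported_subspace E : is_subspace (msupported E).
Proof.
apply/subspaceP; split=> [m|c f g Ef Eg m /msuppD_le]; first by rewrite msupp0.
rewrite mem_cat => /orP[/msuppZ_le|]; [exact: Ef|exact: Eg].
Qed.

Lemma msupportedX E a : msupported E 'X_[a] <-> E a.
Proof.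
split=> [|Ea m]; first by apply; rewrite msuppX inE.
by rewrite msuppX inE => /eqP->.
Qed.

Lemma lin_span_monomials E : lin_span [set 'X_[a] | a in E] = msupported E.
Proof.
apply/seteqP; split.
  apply: lin_span_min; first exact: msupported_subspace.
  by move=> _ [a Ea <-]; apply/msupportedX.
move=> f Ef; rewrite (mpolyE f) big_seq.
apply: subspace_sum; first exact: lin_span_subspace.
by move=> m fm; apply: sub_lin_span; exists m => //; apply: Ef.
Qed.

Lemma msupportedM E f g : (forall a b, E a -> E b -> E (a + b)%MM) ->
  msupported E f -> msupported E g -> msupported E (f * g).
Proof.
move=> ED Ef Eg m /msuppM_le /allpairsP[[a b] /= [fa gb ->]].
by apply: ED; [apply: Ef|apply: Eg].
Qed.

Lemma subalgebraP S : is_subalgebra S <->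
  [/\ S 1, (forall c f g, S f -> S g -> S (c *: f + g))
    & (forall f g, S f -> S g -> S (f * g))].
Proof.
split=> [[S1 SL SM]|[S1 SL SM]]; split.
- by move: S1; rewrite inE.
- by move=> c f g Sf Sg; have := SL c f g; rewrite !inE; apply.
- by move=> f g Sf Sg; have := SM f g; rewrite !inE; apply.
- by rewrite inE.
- by move=> c f g; rewrite !inE; exact: SL.
- by move=> f g; rewrite !inE; exact: SM.
Qed.

Section MonomialAlgebra.
Variable S : set {mpoly k[n]}.
Hypothesis hS : monomial_algebra S.

Lemma monomial_subalgebra : is_subalgebra S.
Proof.
have [A ->] := hS; apply/subalgebraP; split.
- by move=> W [/subalgebraP[]].
- move=> c f g Sf Sg W [sW AW]; have /subalgebraP[_ WL _] := sW.
  by apply: WL; [apply: Sf|apply: Sg].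
- move=> f g Sf Sg W [sW AW]; have /subalgebraP[_ _ WM] := sW.
  by apply: WM; [apply: Sf|apply: Sg].
Qed.

Lemma subalg1 : S 1.
Proof. by have /subalgebraP[] := monomial_subalgebra. Qed.

Lemma subalgM f g : S f -> S g -> S (f * g).
Proof. by have /subalgebraP[_ _] := monomial_subalgebra; apply. Qed.

Lemma subalgL c f g : S f -> S g -> S (c *: f + g).
Proof. by have /subalgebraP[_ SL _] := monomial_subalgebra; apply: SL. Qed.

Lemma subalg0 : S 0.
Proof.
by have := subalgL (-1) subalg1 subalg1; rewrite scaleN1r addNr.
Qed.

Lemma subalgZ c f : S f -> S (c *: f).
Proof. by move=> Sf; rewrite -[_ *: _]addr0; apply: subalgL => //; exact: subalg0. Qed.

Lemma subalgD f g : S f -> S g -> S (f + g).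
Proof. by move=> Sf Sg; rewrite -[f]scale1r; apply: subalgL. Qed.

Lemma subalgC c : S c%:MP.
Proof. by rewrite -[c%:MP]mulr1 mul_mpolyC; apply: subalgZ; exact: subalg1. Qed.

Lemma subalg_prod (I : Type) (r : seq I) (P : pred I) (f : I -> {mpoly k[n]}) :
  (forall i, P i -> S (f i)) -> S (\prod_(i <- r | P i) f i).
Proof.
by move=> Sf; elim/big_ind: _ => //; [exact: subalg1|exact: subalgM].
Qed.

Lemma subalgX f q : S f -> S (f ^+ q).
Proof.
move=> Sf; elim: q => [|q IH]; first by rewrite expr0; exact: subalg1.
by rewrite exprS; apply: subalgM.
Qed.

Lemma expo0 : expo S 0%MM.
Proof. by rewrite /expo /= mpolyX0; exact: subalg1. Qed.

Lemma expoD a b : expo S a -> expo S b -> expo S (a + b)%MM.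
Proof. by rewrite /expo /= mpolyXD; exact: subalgM. Qed.

Lemma expoMn a q : expo S a -> expo S (a *+ q)%MM.
Proof. by rewrite /expo /= -mpolyXn; exact: subalgX. Qed.

Lemma expo_sum (I : Type) (r : seq I) (P : pred I) (f : I -> 'X_{1..n}) :
  (forall i, P i -> expo S (f i)) ->
  expo S (\big[mnm_add/0%MM]_(i <- r | P i) f i).
Proof. by move=> Sf; elim/big_ind: _ => //; [exact: expo0|exact: expoD]. Qed.

(** The polynomials supported on the monoid [expo S] form a subalgebra containing the generating
    monomials, hence containing [S]; conversely they are spanned by monomials of [S]. From here on
    membership in [S] is a condition on exponents alone. *)
Lemma monomial_algebraE : S = msupported (expo S).
Proof.
apply/seteqP; split; last first.
  move=> f; rewrite -lin_span_monomials; apply.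
  split; first by apply/subspaceP; split; [exact: subalg0|exact: subalgL].
  by move=> _ [a Sa <-].
have [A SE] := hS; rewrite {1}SE => f; apply; split.
  apply/subalgebraP; split.
  - by move=> m; rewrite msupp1 inE => /eqP->; exact: expo0.
  - by move=> c g h; have /subspaceP[_] := msupported_subspace (expo S); apply.
  - move=> g h; apply: msupportedM; exact: expoD.
move=> _ [a Aa <-]; apply/msupportedX; rewrite /expo /= SE => W [_].
by apply; exists a.
Qed.

Lemma subalg_msupp f m : S f -> m \in msupp f -> expo S m.
Proof. by rewrite {1}monomial_algebraE; apply. Qed.

End MonomialAlgebra.

End Exponents.

(* The coordinate [ord0] is the total degree, so that [gcoord] also controls
   [mdeg]. *)
Definition gcoord n (a : 'X_{1..n}) (i : 'I_n.+1) : nat :=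
  oapp (fun l => a l) (mdeg a) (unlift ord0 i).

Section Pivots.
Variable n : nat.
Implicit Types (E : set 'X_{1..n}) (a b : 'X_{1..n}) (i : 'I_n.+1).

Lemma gcoordD a b i : gcoord (a + b)%MM i = (gcoord a i + gcoord b i)%N.
Proof. by rewrite /gcoord; case: unlift => [l|] /=; rewrite ?mdegD ?mnmDE. Qed.

Lemma gcoordMn a q i : gcoord (a *+ q)%MM i = (gcoord a i * q)%N.
Proof. by rewrite /gcoord; case: unlift => [l|] /=; rewrite ?mdegMn ?mulmnE. Qed.

Lemma gcoord0 i : gcoord (0%MM : 'X_{1..n}) i = 0%N.
Proof. by rewrite /gcoord; case: unlift => [l|] /=; rewrite ?mdeg0 ?mnm0E. Qed.

Lemma gcoord_sum (I : Type) (r : seq I) (P : pred I) (f : I -> 'X_{1..n}) i :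
  gcoord (\big[mnm_add/0%MM]_(j <- r | P j) f j) i =
  (\sum_(j <- r | P j) gcoord (f j) i)%N.
Proof. exact: (big_morph _ (fun a b => gcoordD a b i) (gcoord0 i)). Qed.

Lemma gcoord_ord0 a : gcoord a ord0 = mdeg a.
Proof. by rewrite /gcoord unlift_none. Qed.

Lemma gcoord_lift a l : gcoord a (lift ord0 l) = a l.
Proof. by rewrite /gcoord liftK. Qed.

Lemma gcoord_le a i : (gcoord a i <= mdeg a)%N.
Proof.
rewrite /gcoord; case: unlift => [l|] //=.
by rewrite mdegE (bigD1 l) //= leq_addr.
Qed.

Lemma gcoord_inj a b : (forall i, gcoord a i = gcoord b i) -> a = b.
Proof. by move=> ab; apply/mnmP=> l; rewrite -!gcoord_lift. Qed.

Definition agree_below i a b : Prop :=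
  forall j : 'I_n.+1, (j < i)%N -> gcoord a j = gcoord b j.

Definition pivot E : {set 'I_n.+1} :=
  [set i | `[< exists a b,
    [/\ E a, E b, agree_below i a b & gcoord a i <> gcoord b i] >]].

Lemma pivotP E i : reflect (exists a b,
    [/\ E a, E b, agree_below i a b & gcoord a i <> gcoord b i])
  (i \in pivot E).
Proof. by rewrite inE; exact: asboolP. Qed.

(** The first coordinate at which two elements of [E] differ is by definition a pivot, so agreement
    at the pivots propagates to all coordinates. *)
Lemma agree_upto E a b (m : nat) : E a -> E b ->
  (forall i : 'I_n.+1, i \in pivot E -> (i < m)%N -> gcoord a i = gcoord b i) ->
  forall i : 'I_n.+1, (i < m)%N -> gcoord a i = gcoord b i.
Proof.
move=> Ea Eb ab; elim: m ab => // m IH ab i.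
have {}IH : forall j : 'I_n.+1, (j < m)%N -> gcoord a j = gcoord b j.
  by apply: IH => j Tj jm; apply: ab => //; apply: ltnW.
rewrite ltnS leq_eqVlt => /predU1P[im|]; last exact: IH.
apply: contrapT => abi; apply: (abi); apply: ab; last by rewrite im.
by apply/pivotP; exists a, b; split=> // j; rewrite im; exact: IH.
Qed.

Lemma pivot_inj E a b : E a -> E b ->
  (forall i, i \in pivot E -> gcoord a i = gcoord b i) -> a = b.
Proof.
move=> Ea Eb ab; apply: gcoord_inj => i.
by apply: (@agree_upto E a b n.+1) => // j Tj _; exact: ab.
Qed.

Definition pivot_pair E i : 'X_{1..n} * 'X_{1..n} :=
  xget (0%MM, 0%MM) [set p | [/\ E p.1, E p.2, agree_below i p.1 p.2
                  & gcoord p.1 i <> gcoord p.2 i]].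

Lemma pivot_pairP E i (p := pivot_pair E i) : i \in pivot E ->
  [/\ E p.1, E p.2, agree_below i p.1 p.2 & gcoord p.1 i <> gcoord p.2 i].
Proof.
case/pivotP=> a [b abP].
suff: [set p | [/\ E p.1, E p.2, agree_below i p.1 p.2
                 & gcoord p.1 i <> gcoord p.2 i]] p by [].
by apply: xgetPex; exists (a, b).
Qed.

End Pivots.

(** * Dimensions of spaces of polynomials *)

Section Dimension.
Variables (k : fieldType) (U : lmodType k).
Implicit Types W X : set U.

Lemma lin_span_tupleP m (f : m.-tuple U) x :
  lin_span [set` f] x <-> exists c : 'I_m -> k, x = \sum_i c i *: tnth f i.
Proof.
split=> [|[c ->]]; last first.
  apply: subspace_sum; first exact: lin_span_subspace.
  by move=> i _; apply: sub_lin_span; rewrite /= mem_tnth.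
apply: (@lin_span_min _ _ _ [set y | exists c, y = \sum_i c i *: tnth f i]).
  apply/subspaceP; split.
    by exists (fun=> 0); rewrite big1 // => i _; rewrite scale0r.
  move=> a _ _ [c ->] [c' ->]; exists (fun i => a * c i + c' i).
  rewrite scaler_sumr -big_split /=; apply: eq_bigr => i _.
  by rewrite scalerA scalerDl.
move=> _ /= /tnthP[i ->]; exists (fun j => (j == i)%:R).
rewrite (bigD1 i) //= eqxx scale1r big1 ?addr0 // => j /negbTE->.
by rewrite scale0r.
Qed.

Lemma lin_indep_le d m (e : d.-tuple U) (f : m.-tuple U) :
  lin_indep e -> (forall i, lin_span [set` f] (tnth e i)) -> (d <= m)%N.
Proof.
move=> eI ef; rewrite leqNgt; apply/negP => md.
have [M eM] := boolp.choice (fun i => proj1 (lin_span_tupleP f _) (ef i)).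
pose A := \matrix_(i < d, j < m) M i j.
(* With more rows than columns, [A] has a nonzero row vector in its left kernel, and this is a
   linear relation among the [e i]. *)
have : kermx A != 0.
  rewrite -mxrank_eq0 mxrank_ker subn_eq0 -ltnNge.
  exact: leq_ltn_trans (rank_leq_col A) md.
case/rowV0Pn=> v /sub_kermxP vA /eqP; apply; apply/rowP => i.
rewrite mxE; apply: (eI (v 0)).
under eq_bigr do rewrite eM scaler_sumr.
rewrite exchange_big big1 //= => j _.
under eq_bigr do rewrite scalerA.
rewrite -scaler_suml; have /rowP/(_ j) := vA; rewrite !mxE => vAj.
rewrite (eq_bigr (fun l => v 0 l * A l j)); last by move=> l _; rewrite mxE.
by rewrite vAj scale0r.
Qed.

Lemma basis_mem W d (e : d.-tuple U) i : is_basis W e -> W (tnth e i).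
Proof. by move=> [_ <-]; apply: sub_lin_span; rewrite /= mem_tnth. Qed.

Lemma vdim_basis W d (e : d.-tuple U) : is_basis W e -> vdim W = d.
Proof.
move=> eW; rewrite /vdim.
have : [set d | exists e : d.-tuple U, is_basis W e]
    (get [set d | exists e : d.-tuple U, is_basis W e]).
  by apply: getPex; exists d, e.
move: (get _) => d' [e' e'W]; apply/eqP; rewrite eqn_leq; apply/andP; split.
  apply: (@lin_indep_le _ _ e' e); first by case: e'W.
  by move=> i; rewrite (proj2 eW); exact: basis_mem e'W.
apply: (@lin_indep_le _ _ e e'); first by case: eW.
by move=> i; rewrite (proj2 e'W); exact: basis_mem eW.
Qed.

Lemma vdim_le W m (f : m.-tuple U) :
  W `<=` lin_span [set` f] -> (vdim W <= m)%N.
Proof.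
move=> Wf; have [[d [e eW]]|noW] := pselect (fin_dim W).
  rewrite (vdim_basis eW); apply: (@lin_indep_le _ _ e f); first by case: eW.
  by move=> i; apply: Wf; exact: basis_mem eW.
(* Without a basis [vdim] takes its default value, which for natural numbers is [0]. *)
by rewrite /vdim getPN // => d [e eW]; apply: noW; exists d, e.
Qed.

Lemma lin_indep_cons d (e : d.-tuple U) x :
  lin_indep e -> ~ lin_span [set` e] x -> lin_indep [tuple of x :: e].
Proof.
move=> eI ex c; rewrite big_ord_recl tnth0.
under eq_bigr do rewrite tnthS.
move=> c0; have cx : c ord0 = 0.
  apply: contrapT => /eqP cx; apply: ex; apply/lin_span_tupleP.
  exists (fun i => - (c ord0)^-1 * c (lift ord0 i)).
  under eq_bigr do rewrite -scalerA.
  rewrite -scaler_sumr; apply: (scalerI cx).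
  rewrite scalerA mulrN divff // scaleN1r; apply/eqP.
  by rewrite -subr_eq0 opprK; apply/eqP.
move: c0; rewrite cx scale0r add0r => /eI c0 i.
by case: (unliftP ord0 i) => [j|] ->.
Qed.

(** Independent families in [W] have length at most [m]; one of maximal length spans [W], since any
    vector outside its span could be added to it. *)
Lemma fin_dim_sub W m (f : m.-tuple U) :
  is_subspace W -> W `<=` lin_span [set` f] -> fin_dim W.
Proof.
move=> sW Wf.
pose P d := `[< exists e : d.-tuple U, lin_indep e /\ forall i, W (tnth e i) >].
have P0 : exists d, P d.
  by exists 0%N; apply/asboolP; exists [tuple]; split=> [c _ []|[]].
have Pm d : P d -> (d <= m)%N.
  case/asboolP=> e [eI eW]; apply: (lin_indep_le eI (f := f)) => i.
  by apply: Wf; exact: eW.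
case: (ex_maxnP P0 Pm) => d /asboolP[e [eI eW]] dmax.
exists d, e; split=> //; apply/seteqP; split.
  by apply: lin_span_min => // _ /= /tnthP[i ->]; exact: eW.
move=> x Wx; apply: contrapT => ex.
suff /dmax : P d.+1 by rewrite ltnn.
apply/asboolP; exists [tuple of x :: e]; split; first exact: lin_indep_cons.
by move=> i; case: (unliftP ord0 i) => [j|] ->; rewrite ?tnth0 ?tnthS.
Qed.

Lemma le_vdim W m (f : m.-tuple U) d (e : d.-tuple U) :
  is_subspace W -> W `<=` lin_span [set` f] -> lin_indep e ->
  (forall i, W (tnth e i)) -> (d <= vdim W)%N.
Proof.
move=> sW Wf eI eW; have [d' [e' e'W]] := fin_dim_sub sW Wf.
rewrite (vdim_basis e'W); apply: (lin_indep_le eI (f := e')) => i.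
by rewrite (proj2 e'W).
Qed.

End Dimension.

Section MonomialDimension.
Variables (k : fieldType) (n : nat).
Implicit Types (W : set {mpoly k[n]}) (s : seq 'X_{1..n}).

Definition monomials s : (size s).-tuple {mpoly k[n]} :=
  [tuple of [seq 'X_[a] | a <- in_tuple s]].

Lemma tnth_monomials s i : tnth (monomials s) i = 'X_[nth 0%MM s i].
Proof. by rewrite /monomials tnth_map (tnth_nth 0%MM). Qed.

Lemma lin_span_monomials_seq s :
  lin_span [set` monomials s] = @msupported k _ [set` s].
Proof.
rewrite -lin_span_monomials; congr lin_span; apply/seteqP; split=> f /=.
  by case/mapP=> a sa ->; exists a.
by case=> a sa <-; apply/mapP; exists a.
Qed.

Lemma lin_indep_monomials s : uniq s -> lin_indep (monomials s).
Proof.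
move=> us c c0 i; have := congr1 (mcoeff (nth 0%MM s i)) c0.
rewrite mcoeff0 linear_sum /= (bigD1 i) //= mcoeffZ tnth_monomials mcoeffX eqxx.
rewrite mulr1 big1 ?addr0 // => j ji.
by rewrite mcoeffZ tnth_monomials mcoeffX nth_uniq // val_eqE (negbTE ji) mulr0.
Qed.

Lemma lin_indep_msupp_le d (e : d.-tuple {mpoly k[n]}) s : lin_indep e ->
  (forall i, @msupported k _ [set` s] (tnth e i)) -> (d <= size s)%N.
Proof.
move=> eI es; apply: (lin_indep_le eI (f := monomials s)).
by rewrite lin_span_monomials_seq.
Qed.

Lemma vdim_msupp_le W s : W `<=` @msupported k _ [set` s] -> (vdim W <= size s)%N.
Proof. by rewrite -lin_span_monomials_seq; exact: vdim_le. Qed.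

Lemma le_vdim_monomials W s s' : is_subspace W ->
  W `<=` @msupported k _ [set` s'] -> uniq s -> (forall a, a \in s -> W 'X_[a]) ->
  (size s <= vdim W)%N.
Proof.
rewrite -lin_span_monomials_seq => sW Ws' us Ws.
apply: (le_vdim sW Ws' (e := monomials s)); first exact: lin_indep_monomials.
by move=> i; rewrite tnth_monomials; apply: Ws; exact: mem_nth.
Qed.

Lemma vdim_monomials s :
  uniq s -> vdim (@msupported k _ [set` s]) = size s.
Proof.
move=> us; apply/eqP; rewrite eqn_leq vdim_msupp_le //=.
apply: (@le_vdim_monomials _ _ s) => //; first exact: msupported_subspace.
by move=> a sa; apply/msupportedX.
Qed.

Lemma fin_dim_monomials s : fin_dim (@msupported k _ [set` s]).
Proof.
apply: (@fin_dim_sub _ _ _ _ (monomials s)); first exact: msupported_subspace.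
by rewrite lin_span_monomials_seq.
Qed.

End MonomialDimension.

(** * Transcendence degree *)

Section Counting.
Variable n : nat.
Implicit Types (E : set 'X_{1..n}) (a b : 'X_{1..n}).

Definition pivot_type E : finType := {i : 'I_n.+1 | i \in pivot E}.

Definition rank E : nat := #|pivot_type E|.

Definition low_monomials E D : seq 'X_{1..n} :=
  [seq bmnm x | x <- enum [pred x : 'X_{1..n < D.+1} | `[< E x >]]].

Lemma mem_low_monomials E D a :
  a \in low_monomials E D <-> E a /\ (mdeg a <= D)%N.
Proof.
split=> [/mapP[b]|[Ea aD]].
  by rewrite mem_enum => /asboolP Eb ->; split=> //; exact: (bmdeg b).
apply/mapP; exists (BMultinom (aD : (mdeg a < D.+1)%N)) => //.
by rewrite mem_enum; apply/asboolP.
Qed.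

Lemma low_monomials_uniq E D : uniq (low_monomials E D).
Proof. by rewrite map_inj_uniq ?enum_uniq //; exact: val_inj. Qed.

Lemma size_low_monomials E D : (size (low_monomials E D) <= D.+1 ^ rank E)%N.
Proof.
rewrite size_map -cardE -[D.+1 in leqRHS]card_ord -card_ffun.
(* Nothing is lost by [inord]: every generalized coordinate is at most the degree, hence at most
   [D]. *)
pose f (a : 'X_{1..n < D.+1}) : {ffun pivot_type E -> 'I_D.+1} :=
  [ffun i => inord (gcoord a (val i))].
have fI : {in [pred a : 'X_{1..n < D.+1} | `[< E a >]] &, injective f}.
  move=> a b /asboolP Ea /asboolP Eb /ffunP ab; apply: val_inj => /=.
  apply: (pivot_inj Ea Eb) => i Ti; have := ab (Sub i Ti).
  rewrite !ffunE => /(congr1 val) /=; rewrite !inordK //.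
    by rewrite ltnS (leq_trans (gcoord_le _ _)) //; exact: (bmdeg b).
  by rewrite ltnS (leq_trans (gcoord_le _ _)) //; exact: (bmdeg a).
by rewrite -(card_in_imset fI) max_card.
Qed.

End Counting.

Section DegreeBound.
Variables (k : fieldType) (n : nat) (E : set 'X_{1..n}).
Hypothesis E0 : E 0%MM.
Hypothesis ED : forall a b, E a -> E b -> E (a + b)%MM.

Definition degree_le D : set {mpoly k[n]} :=
  msupported [set` low_monomials E D].

Lemma degree_leP D f :
  degree_le D f <-> forall m, m \in msupp f -> E m /\ (mdeg m <= D)%N.
Proof.
by split=> fD m fm; [apply/mem_low_monomials|apply/mem_low_monomials]; apply: fD.
Qed.

Lemma degree_le_monotone D D' : (D <= D')%N -> degree_le D `<=` degree_le D'.
Proof.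
move=> DD' f /degree_leP fD; apply/degree_leP => m /fD[? mD].
by split=> //; exact: leq_trans mD DD'.
Qed.

Lemma degree_leM D D' f g :
  degree_le D f -> degree_le D' g -> degree_le (D + D') (f * g).
Proof.
move=> /degree_leP fD /degree_leP gD; apply/degree_leP => m.
move=> /msuppM_le /allpairsP[[a b] /= [/fD[Ea aD] /gD[Eb bD] ->]].
by rewrite mdegD leq_add //; split=> //; exact: ED.
Qed.

Lemma degree_le1 : degree_le 0 1.
Proof. by apply/degree_leP => m; rewrite msupp1 inE => /eqP->; rewrite mdeg0. Qed.

Lemma degree_le_prod (I : Type) (r : seq I) (P : pred I) (D : I -> nat) f :
  (forall i, P i -> degree_le (D i) (f i)) ->
  degree_le (\sum_(i <- r | P i) D i) (\prod_(i <- r | P i) f i).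
Proof.
move=> fD; elim/big_rec2: _ => [|i d g Pi gd]; first exact: degree_le1.
by apply: degree_leM => //; exact: fD.
Qed.

Lemma degree_leX D f q : degree_le D f -> degree_le (D * q) (f ^+ q).
Proof.
move=> fD; elim: q => [|q IH]; first by rewrite muln0 expr0; exact: degree_le1.
by rewrite mulnS exprS; exact: degree_leM.
Qed.

End DegreeBound.

(** Take [N = c.+1 ^ r]. If [r < s], the hypothesis would give [N.+1 ^ r.+1 <= c.+1 ^ r * N.+1 ^ r],
    that is, [N.+1 <= N]. *)
Lemma exponent_le (c r s : nat) :
  (forall N, N.+1 ^ s <= (c * N).+1 ^ r)%N -> (s <= r)%N.
Proof.
move=> /(_ (c.+1 ^ r)%N); set N := (c.+1 ^ r)%N => sr; rewrite leqNgt.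
apply/negP => rs; have : (N.+1 ^ r.+1 <= (c.+1 * N.+1) ^ r)%N.
  apply: leq_trans (leq_pexp2l _ rs) (leq_trans sr _) => //.
  have cN : ((c * N).+1 <= c.+1 * N.+1)%N.
    by rewrite mulSn mulnS addSn ltnS addnA leq_addl.
  by case: (posnP r) => [->|r0] //; rewrite leq_exp2r.
by rewrite expnS expnMn leq_pmul2r ?expn_gt0 // ltnn.
Qed.

Lemma exprf_divM (F : fieldType) (x y : F) (q N : nat) :
  y != 0 -> (q <= N)%N -> (x / y) ^+ q * y ^+ N = x ^+ q * y ^+ (N - q).
Proof.
move=> y0 qN; rewrite -{1}(subnKC qN) exprD expr_div_n mulrA divfK //.
exact: expf_neq0.
Qed.

Section TranscendenceDegree.
Variables (R : realType) (k : fieldType) (n : nat) (S : set {mpoly k[n]}).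
Hypothesis hS : monomial_algebra S.

Lemma subalg_degree_le f : S f -> degree_le (expo S) (msize f) f.
Proof.
move=> Sf; apply/degree_leP => m fm; split; first exact: subalg_msupp hS _ _ Sf fm.
exact/ltnW/msize_mdeg_lt.
Qed.

(** Monomials in [t] with all exponents at most [N] are linearly independent. Multiplied by the
    [N]-th power of the product of the denominators, they become [N.+1 ^ s] independent elements of
    [S] of degree [O(N)], of which counting allows only [O(N ^ r)], where [r] is the rank. *)
Lemma alg_indep_le_rank s (t : s.-tuple {fraction {mpoly k[n]}}) :
  [set` t] `<=` fraction_field S -> alg_indep t -> (s <= rank (expo S))%N.
Proof.
move=> tS tI.
have /boolp.choice[a] : forall i, exists ai : {mpoly k[n]} * {mpoly k[n]},
    [/\ S ai.1, S ai.2, ai.2 != 0 & tnth t i = tofrac ai.1 / tofrac ai.2].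
  by move=> i; have [|x [y ?]] := tS (tnth t i); [exact: mem_tnth|exists (x, y)].
(* [c] adds up degree bounds for all numerators and denominators, so a product using each of them at
   most [N] times has degree at most [c * N]. *)
move=> aP; pose c := (\sum_i (msize (a i).1 + msize (a i).2))%N.
apply: (@exponent_le c) => N.
pose F (al : {ffun 'I_s -> 'I_N.+1}) : {mpoly k[n]} :=
  \prod_i ((a i).1 ^+ al i * (a i).2 ^+ (N - al i)).
pose mon (al : {ffun 'I_s -> 'I_N.+1}) := [multinom (al i : nat) | i < s].
have monI : injective mon.
  move=> al be /mnmP ab; apply/ffunP => i; apply: val_inj.
  by have := ab i; rewrite !mnmE.
pose e := [tuple F (enum_val i) | i < #|{ffun 'I_s -> 'I_N.+1}|].
rewrite -[N.+1 in leqLHS]card_ord -[s in leqLHS]card_ord -card_ffun.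
apply: leq_trans (size_low_monomials (expo S) (c * N)).
apply: (@lin_indep_msupp_le k _ _ e) => [z z0 i|i]; last first.
  rewrite tnth_mktuple -/(degree_le _ _ _) /c big_distrl /=.
  apply: degree_le_prod => [||j _]; [exact: expo0|exact: expoD|].
  rewrite mulnDl; apply: degree_leM; first exact: expoD.
    apply: degree_le_monotone (degree_leX _ _ (subalg_degree_le _)).
    - by rewrite leq_mul2l -ltnS ltn_ord orbT.
    - exact: expo0.
    - exact: expoD.
    - by case: (aP j).
  apply: degree_le_monotone (degree_leX _ _ (subalg_degree_le _)).
  - by rewrite leq_mul2l leq_subr orbT.
  - exact: expo0.
  - exact: expoD.
  - by case: (aP j).
(* A linear relation [z] among the cleared products is, after division by the common denominator,
   the algebraic relation [p] among the entries of [t]. *)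
pose p : {mpoly k[s]} := \sum_j z j *: 'X_[mon (enum_val j)].
suff p0 : p = 0.
  have := congr1 (mcoeff (mon (enum_val i))) p0.
  rewrite mcoeff0 linear_sum /= (bigD1 i) //= mcoeffZ mcoeffX eqxx mulr1.
  rewrite big1 ?addr0 // => j ji; rewrite mcoeffZ mcoeffX (inj_eq monI).
  by rewrite (inj_eq enum_val_inj) (negbTE ji) mulr0.
apply: tI; pose phi : {rmorphism k -> {fraction {mpoly k[n]}}} :=
  (@tofrac {mpoly k[n]} \o @mpolyC n k : {rmorphism _ -> _}).
change (mmap phi (tnth t) p = 0); rewrite /p raddf_sum /=.
have b0 : \prod_j tofrac (a j).2 ^+ N != 0.
  by apply/prodf_neq0 => j _; rewrite expf_neq0 // tofrac_eq0; case: (aP j).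
apply: (mulIf b0); rewrite mul0r mulr_suml.
transitivity (tofrac (\sum_j z j *: tnth e j)); last by rewrite z0 rmorph0.
rewrite rmorph_sum; apply: eq_bigr => j _.
rewrite mmapZ mmapX /= tnth_mktuple -mul_mpolyC rmorphM -mulrA; congr (_ * _).
rewrite /mmap1 -big_split rmorph_prod /=; apply: eq_bigr => l _.
case: (aP l) => _ _ b0l ->; rewrite mnmE rmorphM !rmorphXn /=.
by apply: exprf_divM; [rewrite tofrac_eq0|rewrite -ltnS ltn_ord].
Qed.

Lemma trdeg_le_rank : (trdeg R S <= (rank (expo S))%:R%:E)%E.
Proof.
apply: ub_ereal_sup => _ [s [t [tS tI]] <-].
by rewrite lee_fin ler_nat; exact: alg_indep_le_rank tS tI.
Qed.

End TranscendenceDegree.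

(** * Chains of primes *)

Lemma chain_dimS (A : comNzRingType) (R : realType) (C C' : set (set A)) :
  C `<=` C' -> (chain_dim R C <= chain_dim R C')%E.
Proof.
move=> CC'; apply: ereal_sup_le => _ [r [p [pC pp]] <-]; exists r => //.
by exists p; split=> // i ir; apply/CC'/pC.
Qed.

Section PrimeChains.
Variables (R : realType) (k : fieldType) (n : nat) (S : set {mpoly k[n]}).
Hypothesis hS : monomial_algebra S.
Implicit Types (P : set {mpoly k[n]}) (f g : {mpoly k[n]}).

Lemma gr_krull_le_krull : (gr_krull_dim R S <= krull_dim R S)%E.
Proof. by apply: chain_dimS => P []. Qed.

Lemma prime_ideal_sub P f : is_prime_ideal S P -> P f -> S f.
Proof. by case=> [[PS _ _ _] _ _]; exact: PS. Qed.

Lemma prime_ideal_sum P (I : Type) (r : seq I) (Q : pred I) (f : I -> {mpoly k[n]}) :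
  is_prime_ideal S P -> (forall i, Q i -> P (f i)) ->
  P (\sum_(i <- r | Q i) f i).
Proof. by case=> [[_ P0 PD _] _ _] Pf; elim/big_ind: _. Qed.

Lemma prime_ideal_subr P f g : is_prime_ideal S P -> P (f + g) -> P g -> P f.
Proof.
case=> [[_ P0 PD PM] _ _] Pfg Pg; rewrite -[f](addrK g); apply: PD => //.
by rewrite -mulN1r; apply: PM => //; rewrite -mpolyC1 -mpolyCN; exact: subalgC.
Qed.

Lemma prime_ideal_cancel P f q g : is_prime_ideal S P -> S f -> ~ P f -> S g ->
  P (f ^+ q * g) -> P g.
Proof.
case=> _ _ PP Sf Pf Sg; elim: q => [|q IH]; first by rewrite mul1r.
rewrite exprS -mulrA => /PP[] //; apply: subalgM => //; exact: subalgX.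
Qed.

Lemma prime_ideal_const P c : is_prime_ideal S P -> P c%:MP -> c = 0.
Proof.
case=> [[_ _ _ PM] P1 _] Pc; apply: contrapT => /eqP c0; apply: P1.
rewrite -mpolyC1 -(mulVf c0) mpolyCM; apply: PM => //; exact: subalgC.
Qed.

Section Witnesses.
Variables (r : nat) (p : nat -> set {mpoly k[n]}) (y : 'I_r -> {mpoly k[n]}).
Hypothesis pprime : forall i, (i <= r)%N -> is_prime_ideal S (p i).
Hypothesis py : forall i : 'I_r, p i.+1 (y i).
Hypothesis npy : forall i : 'I_r, ~ p i (y i).
Hypothesis ple : forall i, (i < r)%N -> p i `<=` p i.+1.

Lemma witness_sub i : S (y i).
Proof. exact: prime_ideal_sub (pprime (ltn_ord i)) (py i). Qed.

Definition tail_monomial (i : nat) (m : 'X_{1..r}) : {mpoly k[n]} :=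
  \prod_(l < r | (i <= l)%N) y l ^+ m l.

Lemma tail_monomial_sub i m : S (tail_monomial i m).
Proof. by apply: subalg_prod => // l _; apply: subalgX => //; exact: witness_sub. Qed.

Lemma tail_monomialS (i : 'I_r) m :
  tail_monomial i m = y i ^+ m i * tail_monomial i.+1 m.
Proof.
rewrite /tail_monomial (bigD1 i) //=; congr (_ * _); apply: eq_bigl => l.
by rewrite ltn_neqAle andbC eq_sym.
Qed.

(* Modulo [p i] one may cancel the least power of [y i], and modulo [p i.+1]
   only the monomials of least degree in [y i] survive. *)
Lemma tail_sum_notin d i (c : 'X_{1..r} -> k) (s : seq 'X_{1..r}) :
  (i + d = r)%N -> uniq s -> s != [::] -> {in s, forall m, c m != 0} ->
  {in s &, forall (m m' : 'X_{1..r}) (l : 'I_r), (l < i)%N -> m l = m' l} ->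
  ~ p i (\sum_(m <- s) c m *: tail_monomial i m).
Proof.
elim: d i s => [|d IH] i s.
  (* Base case [i = r]: the exponents in [s] agree everywhere, so [s] is a singleton, and the sum is
     a nonzero constant, which lies in no prime. *)
  rewrite addn0 => -> us s0 c0 agree; case: s us s0 c0 agree => // m [|m' s].
    move=> _ _ c0 _; rewrite big_seq1 /tail_monomial big_pred0 => [|l]; last first.
      by rewrite leqNgt ltn_ord.
    rewrite -mul_mpolyC mulr1 => /(prime_ideal_const (pprime (leqnn r))) cm.
    by move: (c0 m); rewrite inE eqxx cm eqxx => /(_ isT).
  move=> us _ _ agree; suff mm' : m = m' by move: us; rewrite mm' /= inE eqxx.
  by apply/mnmP => l; apply: agree; rewrite ?inE ?eqxx ?orbT.
move=> idr us s0 c0 agree; have ir : (i < r)%N by rewrite -idr addnS ltnS leq_addr.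
pose j := Ordinal ir; have [m0 ms0] : exists m0, m0 \in s.
  by case: s s0 {us c0 agree} => // m s _; exists m; rewrite inE eqxx.
pose Pv v := has (fun m : 'X_{1..r} => m j == v) s.
have Pv0 : exists v, Pv v by exists (m0 j); apply/hasP; exists m0.
case: (ex_minnP Pv0) => v /hasP[m1 ms1 /eqP m1v] vmin.
have {}vmin m : m \in s -> (v <= m j)%N by move=> ms; apply: vmin; apply/hasP; exists m.
pose s' := [seq m <- s | (m : 'X_{1..r}) j == v].
move=> psum; apply: (IH i.+1 s') => //.
- by rewrite -idr addSnnS.
- exact: filter_uniq.
- apply/eqP => s'0; have : m1 \in s' by rewrite mem_filter m1v eqxx ms1.
  by rewrite s'0.
- by move=> m; rewrite mem_filter => /andP[_ /c0].
- move=> m m'; rewrite !mem_filter => /andP[/eqP mv ms] /andP[/eqP m'v ms'] l.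
  rewrite ltnS leq_eqVlt => /predU1P[lj|li]; last exact: agree.
  by rewrite (_ : l = j) ?mv ?m'v //; exact: val_inj.
have pi1 := pprime (ltnW ir); have pi2 := pprime ir.
pose g m := c m *: (y j ^+ (m j - v) * tail_monomial i.+1 m).
have Sg m : S (g m).
  apply: subalgZ => //; apply: subalgM => //; last exact: tail_monomial_sub.
  by apply: subalgX => //; exact: witness_sub.
have : p i (\sum_(m <- s) g m).
  apply: (@prime_ideal_cancel _ _ v _ pi1 (witness_sub j) (@npy j)).
    by elim/big_ind: _ => //; [exact: subalg0|move=> ? ?; exact: subalgD].
  rewrite mulr_sumr; rewrite big_seq in psum; rewrite big_seq.
  rewrite (eq_bigr (fun m => c m *: tail_monomial i m)) // => m ms.
  rewrite /g -scalerAr mulrA -exprD subnKC; last exact: vmin.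
  by rewrite (tail_monomialS j).
move/(ple ir); rewrite (bigID (fun m : 'X_{1..r} => m j == v)) /= => gsum.
rewrite /s' big_filter.
rewrite (eq_bigr g) => [|m /eqP mv]; last by rewrite /g mv subnn expr0 mul1r.
apply: (prime_ideal_subr pi2 gsum).
rewrite big_seq_cond; apply: prime_ideal_sum => // m /andP[ms mv].
have vm : (v < m j)%N by rewrite ltn_neqAle eq_sym mv vmin.
have [[_ _ _ PM] _ _] := pi2.
rewrite /g -(subnSK vm) exprS -mulrA scalerAr mulrC; apply: PM; last exact: (py j).
apply: subalgZ => //; apply: subalgM => //; last exact: tail_monomial_sub.
by apply: subalgX => //; exact: witness_sub.
Qed.

(** A nontrivial algebraic relation would be a combination of full monomials in the [y i] with value
    [0], an element of [p 0]. At [i = 0] the agreement condition on the exponents is empty. *)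
Lemma witnesses_alg_indep : alg_indep [tuple tofrac (y i) | i < r].
Proof.
move=> f f0; apply: contrapT => /eqP fn0.
apply: (@tail_sum_notin r 0 (fun m => f@_m) (msupp f)) => //.
- by rewrite msupp_eq0.
- by move=> m; rewrite mcoeff_msupp.
suff -> : \sum_(m <- msupp f) f@_m *: tail_monomial 0 m = 0.
  by case: (pprime (leq0n r)) => [[]].
apply/eqP; rewrite -tofrac_eq0 -f0 rmorph_sum /=; apply/eqP; apply: eq_bigr => m _.
rewrite -mul_mpolyC rmorphM /tail_monomial rmorph_prod; congr (_ * _).
by apply: eq_big => // l _; rewrite rmorphXn /= tnth_mktuple.
Qed.

End Witnesses.

Lemma krull_le_trdeg : (krull_dim R S <= trdeg R S)%E.
Proof.
apply: ereal_sup_le => _ [r [p [pprime pp]] <-].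
exists r => //.
have /boolp.choice[y yP] : forall i : 'I_r, exists y, p i.+1 y /\ ~ p i y.
  move=> i; apply: contrapT => no_y; case: (pp i (ltn_ord i)) => _; apply.
  by move=> y piy; apply: contrapT => npiy; apply: no_y; exists y.
exists [tuple tofrac (y i) | i < r]; split; last first.
  apply: (witnesses_alg_indep pprime) => [i|i|i ir]; [exact: (yP i).1|exact: (yP i).2|].
  by case: (pp i ir).
move=> _ /= /mapP[i _ ->]; exists (y i), 1; split.
- exact: prime_ideal_sub (pprime i.+1 (ltn_ord i)) (yP i).1.
- exact: subalg1.
- exact: oner_neq0.
- by rewrite rmorph1 divr1.
Qed.

End PrimeChains.

(** * Graded primes *)

(** The sets are added in decreasing order, starting from [F 0]. At a position in [T] the new set is
    put below the chain; elsewhere it replaces the bottom member, which keeps the next inclusion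
    strict. *)
Lemma strict_subchain (A : Type) (C : set (set A)) (F : nat -> set A)
    (T : pred nat) (N : nat) :
  (forall i, (i <= N)%N -> C (F i)) ->
  (forall i, (i < N)%N -> F i.+1 `<=` F i) ->
  (forall i, (i < N)%N -> T i -> ~ F i `<=` F i.+1) ->
  exists p : nat -> set A, [/\ p 0%N = F N,
    forall i, (i <= count T (iota 0 N))%N -> C (p i) &
    forall i, (i < count T (iota 0 N))%N -> p i `<` p i.+1].
Proof.
elim: N => [|N IH] CF Fle FT.
  by exists F; split=> // i; rewrite leqn0 => /eqP->; exact: CF.
have [i iN|i iN|i iN|p [p0 Cp pp]] := IH.
- by apply: CF; exact: leqW.
- by apply: Fle; exact: leqW.
- by apply: FT; exact: leqW.
rewrite -addn1 iotaD add0n count_cat /= addn0.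
case TN: (T N); rewrite ?addn1 ?addn0.
  exists (fun j => if j is j'.+1 then p j' else F N.+1); split=> //.
    by case=> [|j] jr; [exact: CF|exact: Cp].
  case=> [|j] jr; last exact: pp.
  by rewrite p0; split; [exact: Fle|exact: FT].
exists (fun j => if j is j'.+1 then p j else F N.+1); split=> //.
  by case=> [|j] jr; [exact: CF|exact: Cp].
case=> [|j] jr; last exact: pp.
case: (pp _ jr); rewrite p0 => le nle; split.
  by apply: subset_trans le; exact: Fle.
by move=> /subset_trans/(_ (Fle _ (leqnn _))).
Qed.

Section GradedPrimes.
Variables (R : realType) (k : fieldType) (n : nat) (S : set {mpoly k[n]}).
Hypothesis hS : monomial_algebra S.
Implicit Types (f g : {mpoly k[n]}).

(** The shift comes from the degree occupying generalized coordinate [0]: the exponent of ['X_l] is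
    coordinate [l.+1]. Weight [1] forgets a variable, whereas weight [0] kills it. *)
Definition partial_weight (i : nat) (l : 'I_n) : {mpoly k[n]} :=
  if i == 0%N then 0 else if (l.+1 < i)%N then 'X_l else 1.

(* For [0 < i] a monomial is sent to its first [i] generalized coordinates,
   the degree being recorded by ['X]; for [i = 0] only the constant coefficient
   survives. *)
Definition partial_eval (i : nat) : {mpoly k[n]} -> {poly {mpoly k[n]}} :=
  mmap (@polyC {mpoly k[n]} \o @mpolyC n k)
       (fun l => 'X * (partial_weight i l)%:P).

HB.instance Definition _ i := GRing.RMorphism.on (partial_eval i).

Definition partial_ker i : set {mpoly k[n]} := [set f | S f /\ partial_eval i f = 0].

Lemma partial_evalX i m :
  partial_eval i 'X_[m] = 'X^(mdeg m) * (mmap1 (partial_weight i) m)%:P.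
Proof.
rewrite /partial_eval mmapX /mmap1 mdegE -prodrXr rmorph_prod -big_split /=.
by apply: eq_bigr => l _; rewrite exprMn rmorphXn.
Qed.

Lemma partial_evalZ i c f :
  partial_eval i (c *: f) = c%:MP%:P * partial_eval i f.
Proof. exact: mmapZ. Qed.

Lemma partial_evalE i f : partial_eval i f =
  \sum_(m <- msupp f) (f@_m *: mmap1 (partial_weight i) m)%:P * 'X^(mdeg m).
Proof.
rewrite {1}(mpolyE f) raddf_sum; apply: eq_bigr => m _.
by rewrite /= partial_evalZ partial_evalX -mul_mpolyC polyCM -mulrA commr_polyXn.
Qed.

Lemma partial_ker_prime i : is_prime_ideal S (partial_ker i).
Proof.
split; first split.
- by move=> f [].
- by split; [exact: subalg0|exact: raddf0].
- move=> f g [Sf f0] [Sg g0]; split; first exact: subalgD.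
  by rewrite raddfD /= f0 g0 addr0.
- move=> f g Sf [Sg g0]; split; first exact: subalgM.
  by rewrite rmorphM /= g0 mulr0.
- by case=> _ /eqP; rewrite rmorph1 oner_eq0.
- move=> f g Sf Sg [_ /eqP]; rewrite rmorphM mulf_eq0.
  by case/orP=> /eqP ?; [left|right].
Qed.

(** The power of ['X] records the degree, so the component of degree [d] of [f] is mapped to the
    term of degree [d] of the image of [f]. *)
Lemma partial_ker_homogeneous i : is_homogeneous (partial_ker i).
Proof.
move=> f [Sf f0] d; split.
  rewrite pihomogE big_seq_cond; elim/big_rec: _ => [|m g /andP[fm _]].
    exact: subalg0.
  apply: subalgL => //; exact: (subalg_msupp hS Sf).
have -> : partial_eval i (pihomog mdeg d f) = (partial_eval i f)`_d *: 'X^d.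
  rewrite pihomogE raddf_sum partial_evalE coef_sum scaler_suml.
  rewrite big_mkcond /=; apply: eq_bigr => m _.
  rewrite coefCM coefXn eq_sym; case: eqP => [->|_]; last by rewrite mulr0 scale0r.
  rewrite partial_evalZ partial_evalX mulr1 -mul_mpolyC.
  by rewrite -mul_polyC polyCM -mulrA commr_polyXn.
by rewrite f0 coef0 scale0r.
Qed.

(** The map [partial_eval i] factors through [partial_eval i.+1]: for [i = 0] by setting ['X] to
    [0], and otherwise by substituting the weights of level [i] in the coefficients. *)
Lemma partial_ker_le i : partial_ker i.+1 `<=` partial_ker i.
Proof.
move=> f [Sf f0]; split; first exact: Sf.
have factor (psi : {rmorphism {poly {mpoly k[n]}} -> {poly {mpoly k[n]}}}) :
    (forall c : k, psi c%:MP%:P = c%:MP%:P) ->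
    (forall l, psi ('X * (partial_weight i.+1 l)%:P) =
               'X * (partial_weight i l)%:P) -> partial_eval i f = 0.
  move=> psiC psiX; rewrite -(rmorph0 psi) -f0 /partial_eval /mmap rmorph_sum.
  apply: eq_bigr => m _; rewrite rmorphM /= psiC; congr (_ * _).
  by rewrite /mmap1 rmorph_prod; apply: eq_bigr => l _; rewrite rmorphXn psiX.
case: i factor f0 => [|i] factor f0.
  apply: (factor (@polyC {mpoly k[n]} \o horner_eval (0 : {mpoly k[n]}))).
    by move=> c /=; rewrite /horner_eval hornerC.
  by move=> l /=; rewrite /horner_eval hornerM hornerX mul0r mulr0.
apply: (factor (map_poly (mmap (@mpolyC n k) (partial_weight i.+1)))).
  by move=> c /=; rewrite map_polyC /= mmapC.
move=> l /=; rewrite rmorphM /= map_polyX map_polyC /=; congr (_ * _%:P).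
rewrite {2}/partial_weight /= ltnS; case: ifP => [li|il].
  by rewrite mmapX mmap1U.
rewrite rmorph1 /partial_weight /=.
by have -> : (l.+1 < i.+1)%N = false by apply: contraFF il => /ltnW.
Qed.

Lemma partial_evalX_neq0 i m : (0 < i)%N -> partial_eval i 'X_[m] != 0.
Proof.
move=> i0; rewrite partial_evalX mulf_neq0 // ?expf_neq0 ?polyX_eq0 //.
rewrite polyC_eq0; apply/prodf_neq0 => l _; apply: expf_neq0.
rewrite /partial_weight eqn0Ngt i0 /=; case: ifP => _; last exact: oner_neq0.
by rewrite -msupp_eq0 msuppX.
Qed.

Lemma mmap1_partial_weight i m : (0 < i)%N ->
  mmap1 (partial_weight i) m =
  'X_[[multinom (if (l.+1 < i)%N then m l else 0%N) | l < n]].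
Proof.
move=> i0; rewrite mpolyXE_id; apply: eq_bigr => l _.
rewrite mnmE /partial_weight eqn0Ngt i0 /=; case: ifP => // _.
by rewrite expr1n expr0.
Qed.

(** At the pivot [0] a monomial of positive degree separates the two kernels. At a later pivot the
    binomial ['X_[a] - 'X_[b]] does: its two monomials have the same first [i] coordinates and
    differ in the next one. *)
Lemma partial_ker_strict (i : 'I_n.+1) : i \in pivot (expo S) ->
  ~ partial_ker i `<=` partial_ker i.+1.
Proof.
case/pivotP=> a [b [Sa Sb ab abi]] /= le.
have [i0|i0] := posnP i.
  have {ab abi} : mdeg a <> mdeg b.
    by move: abi; rewrite (_ : i = ord0) ?gcoord_ord0 //; exact: val_inj.
  wlog a0 : a b Sa Sb / (0 < mdeg a)%N => [th|] abi.
    case: (posnP (mdeg a)) => [a0|]; last by move=> ?; exact: (th a b).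
    apply: (th b a) => //; last by move/esym.
    by rewrite lt0n; apply/eqP => b0; apply: abi; rewrite a0.
  have [] : partial_ker i.+1 'X_[a]; last first.
    by move=> _ /eqP; apply/negP; exact: partial_evalX_neq0.
  apply: le; split=> //; rewrite partial_evalX i0.
  suff -> : mmap1 (partial_weight 0) a = 0 by rewrite polyC0 mulr0.
  have [l al] : exists l, (0 < a l)%N.
    apply: contrapT => no_l; move: a0; rewrite mdegE big1 // => l _.
    by apply/eqP; rewrite -leqn0 leqNgt; apply/negP => al; apply: no_l; exists l.
  by rewrite /mmap1 (bigD1 l) //= /partial_weight /= expr0n eqn0Ngt al mul0r.
have ab0 : mdeg a = mdeg b by have := ab ord0 i0; rewrite !gcoord_ord0.
have [] : partial_ker i.+1 ('X_[a] - 'X_[b]).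
  apply: le; split.
    by rewrite addrC -scaleN1r; exact: subalgL.
  apply/eqP; rewrite rmorphB subr_eq0 /= !partial_evalX ab0; apply/eqP.
  congr (_ * _%:P); rewrite !mmap1_partial_weight //; congr 'X_[_].
  apply/mnmP => l; rewrite !mnmE; case: ifP => // li.
  by have := ab (lift ord0 l); rewrite !gcoord_lift; apply.
move=> _ /eqP; rewrite rmorphB subr_eq0 /= !partial_evalX ab0 => /eqP.
move/(mulfI (monic_neq0 (monicXn _ _)))/polyC_inj.
rewrite !mmap1_partial_weight // => /(congr1 (@msupp _ _)).
rewrite !msuppX => /(congr1 (head 0%MM)) /= /mnmP eab; apply: abi.
case: (unliftP ord0 i) i0 eab => [l|] -> // _ /(_ l).
by rewrite !mnmE !gcoord_lift /= ltnSn.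
Qed.

Lemma count_pivot (E : set 'X_{1..n}) :
  count (fun i => i \in [seq val j | j <- enum (pivot E)]) (iota 0 n.+1) = rank E.
Proof.
rewrite /rank card_sig -val_enum_ord count_map cardE size_filter enumT.
apply: eq_count => i /=; rewrite mem_map ?mem_enum //; exact: val_inj.
Qed.

Lemma rank_le_gr_krull : ((rank (expo S))%:R%:E <= gr_krull_dim R S)%E.
Proof.
apply: ereal_sup_ubound; exists (rank (expo S)) => //.
have [] := @strict_subchain _
  [set P | is_prime_ideal S P /\ is_homogeneous P] partial_ker
  (fun i => i \in [seq val j | j <- enum (pivot (expo S))]) n.+1.
- by move=> i _; split; [exact: partial_ker_prime|exact: partial_ker_homogeneous].
- by move=> i _; exact: partial_ker_le.
- move=> i _ /mapP[j]; rewrite mem_enum => jT ->; exact: partial_ker_strict.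
move=> p [_ Cp pp].
by rewrite count_pivot in Cp pp; exists p.
Qed.

End GradedPrimes.

(** * Combinations of pivot pairs *)

Section PivotCombinations.
Variables (n : nat) (E : set 'X_{1..n}).
Implicit Types (a : 'X_{1..n}) (j : pivot_type E).

Definition pivot_fst j : 'X_{1..n} := (pivot_pair E (val j)).1.
Definition pivot_snd j : 'X_{1..n} := (pivot_pair E (val j)).2.

Lemma pivot_typeP j : [/\ E (pivot_fst j), E (pivot_snd j),
  agree_below (val j) (pivot_fst j) (pivot_snd j)
  & gcoord (pivot_fst j) (val j) <> gcoord (pivot_snd j) (val j)].
Proof. exact: pivot_pairP (valP j). Qed.

(** Every pair is used [q] times in total, so in the coordinates before its pivot, where its two
    members agree, its contribution is independent of [c]. *)
Definition pivot_comb q (c : pivot_type E -> nat) : 'X_{1..n} :=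
  \big[mnm_add/0%MM]_j (pivot_fst j *+ c j + pivot_snd j *+ (q - c j))%MM.

Lemma gcoord_pivot_comb q c i : gcoord (pivot_comb q c) i =
  (\sum_j (gcoord (pivot_fst j) i * c j + gcoord (pivot_snd j) i * (q - c j)))%N.
Proof.
by rewrite gcoord_sum; apply: eq_bigr => j _; rewrite gcoordD !gcoordMn.
Qed.

(* Triangularity: in coordinate [j] the pairs of later pivots contribute a
   constant, and those of earlier pivots have been dealt with. *)
Lemma pivot_comb_inj q a a' (c c' : pivot_type E -> nat) :
  (forall j, c j <= q)%N -> (forall j, c' j <= q)%N ->
  (forall j, (gcoord a (val j) +
      (gcoord (pivot_fst j) (val j) * c j + gcoord (pivot_snd j) (val j) * (q - c j))
    = gcoord a' (val j) +
      (gcoord (pivot_fst j) (val j) * c' j + gcoord (pivot_snd j) (val j) * (q - c' j)))%N ->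
    c j = c' j) ->
  (a + pivot_comb q c)%MM = (a' + pivot_comb q c')%MM -> c =1 c' /\ a = a'.
Proof.
move=> cq c'q sep eq_comb; suff cc' : c =1 c'.
  split=> //; move: eq_comb; rewrite /pivot_comb.
  by under eq_bigr do rewrite cc'; exact: addIm.
have IH m j : (val j < m)%N -> c j = c' j.
  elim: m j => // m IH j; rewrite ltnS leq_eqVlt => /predU1P[jm|]; last exact: IH.
  apply: sep; have := congr1 (fun b => gcoord b (val j)) eq_comb.
  rewrite !gcoordD !gcoord_pivot_comb (bigD1 j) //= [in RHS](bigD1 j) //= !addnA.
  rewrite [X in (_ + X)%N = _](_ : _ = \sum_(l | l != j)
    (gcoord (pivot_fst l) (val j) * c' l +
     gcoord (pivot_snd l) (val j) * (q - c' l)))%N; first by move/addIn.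
  apply: eq_bigr => l lj; case: (ltnP (val l) (val j)) => [lm|].
    by rewrite (IH l) // -jm.
  rewrite leq_eqVlt => /predU1P[/val_inj/val_inj jl|jl].
    by rewrite jl eqxx in lj.
  have [_ _ /(_ _ jl) -> _] := pivot_typeP l.
  by rewrite -!mulnDr !subnKC.
by move=> j; apply: (IH n.+1).
Qed.

Definition pivot_degree : nat := (\sum_j (mdeg (pivot_fst j) + mdeg (pivot_snd j)))%N.

Lemma mdeg_pivot_comb q c : (forall j, c j <= q)%N ->
  (mdeg (pivot_comb q c) <= pivot_degree * q)%N.
Proof.
move=> cq; rewrite mdeg_sum /pivot_degree big_distrl /=.
apply: leq_sum => j _; rewrite mdegD !mdegMn mulnDl leq_add //.
  by rewrite leq_mul2l cq orbT.
by rewrite leq_mul2l leq_subr orbT.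
Qed.

Lemma card_pivot_fun q : #|{ffun pivot_type E -> 'I_q}| = (q ^ rank E)%N.
Proof. by rewrite card_ffun card_ord. Qed.

End PivotCombinations.

(** * Growth exponents through logarithms *)

Section GrowthRate.
Variable R : realType.
Implicit Types (f : nat -> R) (r K : R).

Lemma ln_nat_unbounded K : exists N, forall m, (N <= m)%N -> K <= ln (m%:R : R).
Proof.
exists (Num.truncn (expR K)).+1 => m Km; rewrite -[K]expRK.
have Km' : expR K <= m%:R.
  by apply/ltW/(lt_le_trans (truncnS_gt _)); rewrite ler_nat.
by rewrite ler_ln // posrE ?expR_gt0 //; apply: lt_le_trans Km'; exact: expR_gt0.
Qed.

Lemma near_rate_le K e : 0 < e -> \forall m \near \oo, K / ln (m%:R : R) <= e.
Proof.
move=> e0; have [N1 hN1] := ln_nat_unbounded 1; have [N hN] := ln_nat_unbounded (K / e).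
exists (maxn N1 N) => // m /=; rewrite geq_max => /andP[/hN1 m1 /hN mK].
by rewrite ler_pdivrMr ?(lt_le_trans ltr01) // mulrC -ler_pdivrMr.
Qed.

Lemma limn_esup_le_rate f r K : (forall m, (1 < m)%N -> f m <= r + K / ln m%:R) ->
  (limn_esup (fun m => (f m)%:E) <= r%:E)%E.
Proof.
move=> fr; apply/lee_addgt0Pr => e e0.
(* The limit superior is the infimum, over the sets of the filter, of the suprema of [f] on them;
   the set where [f m <= r + e] is one of these. *)
apply: (@le_trans _ _ (ereal_sup [set (f m)%:E | m in [set m | f m <= r + e]])).
  apply: ereal_inf_lbound; exists [set m | f m <= r + e] => //.
  have K_e := near_rate_le K e0; near=> m => /=.
  have m1 : (1 < m)%N by near: m; exists 2%N.
  by apply: le_trans (fr m m1) _; rewrite lerD2l; near: m.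
by apply: ub_ereal_sup => _ [m fm <-]; rewrite -EFinD lee_fin.
Unshelve. all: by end_near. Qed.

Lemma limn_esup_ge_rate f r K : (forall m, (1 < m)%N -> r - K / ln m%:R <= f m) ->
  (r%:E <= limn_esup (fun m => (f m)%:E))%E.
Proof.
move=> fr; apply/lee_addgt0Pr => e e0; rewrite -leeBlDr //.
apply: le_ereal_inf_tmp => _ [V ooV <-].
have K_e := near_rate_le K e0.
(* Every set [V] of the filter contains an index at which [f] is at least [r - e], so each of the
   suprema is at least [r - e]. *)
have [N _ hN] : \forall m \near \oo, V m /\ r - e <= f m.
  near=> m; split; first by near: m.
  have m1 : (1 < m)%N by near: m; exists 2%N.
  by apply: le_trans _ (fr m m1); rewrite lerD2l lerN2; near: m.
have [VN fN] := hN N (leqnn _).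
apply: (@le_trans _ _ (f N)%:E); first by rewrite -EFinB lee_fin.
by apply: ereal_sup_ubound; exists N.
Unshelve. all: by end_near. Qed.

(** Since [(c * m).+1 <= c.+1 * m], taking logarithms leaves only an error of constant size, divided
    by [ln m]. *)
Lemma ln_growth_le (G c r m : nat) : (1 < m)%N -> (G <= (c * m).+1 ^ r)%N ->
  ln (G%:R : R) / ln m%:R <= r%:R + r%:R * ln c.+1%:R / ln m%:R.
Proof.
move=> m1 Gle; have lnm : 0 < ln (m%:R : R) by rewrite ln_gt0 // ltr1n.
rewrite ler_pdivrMr // mulrDl divfK ?gt_eqF //.
have [->|G0] := posnP G.
  by rewrite (le_trans (ln_le0 _)) // addr_ge0 // mulr_ge0 ?ln_ge0 ?ler1n // ltnW.
have m0 : (0 < m)%N by exact: ltnW.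
rewrite addrC -mulrDr -lnM ?posrE ?ltr0n // [leRHS]mulr_natl -lnXn; last first.
  by rewrite mulr_gt0 ?ltr0n.
rewrite ler_ln ?posrE ?ltr0n ?exprn_gt0 ?mulr_gt0 ?ltr0n //.
rewrite -natrM -natrX ler_nat (leq_trans Gle) //.
have cm : ((c * m).+1 <= c.+1 * m)%N by rewrite mulSn -addn1 addnC leq_add2r.
by case: (posnP r) => [->|r0] //; rewrite leq_exp2r.
Qed.

Lemma ln_growth_ge (G c r m : nat) : (1 < m)%N -> (0 < c)%N -> (0 < G)%N ->
  (m ^ r <= c ^ r * G)%N ->
  r%:R - r%:R * ln c%:R / ln m%:R <= ln (G%:R : R) / ln m%:R.
Proof.
move=> m1 c0 G0 leG; have lnm : 0 < ln (m%:R : R) by rewrite ln_gt0 // ltr1n.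
have m0 : (0 < m)%N by exact: ltnW.
rewrite ler_pdivlMr // mulrBl divfK ?gt_eqF // lerBlDr !mulr_natl -!lnXn ?ltr0n //.
rewrite -lnM ?posrE ?exprn_gt0 ?ltr0n // ler_ln ?posrE ?mulr_gt0 ?exprn_gt0 ?ltr0n //.
by rewrite -!natrX -natrM ler_nat mulnC.
Qed.

End GrowthRate.

(** * Gelfand-Kirillov dimension *)

Section PowerProducts.
Variables (k : fieldType) (n : nat).
Implicit Types (V : set {mpoly k[n]}) (f g : {mpoly k[n]}).

(** This is the set spanning [space_exp V m], isolated because products of its members
    concatenate. *)
Definition power_products V m : set {mpoly k[n]} :=
  [set f | exists v : 'I_m -> {mpoly k[n]},
    (forall i, V (v i)) /\ f = \prod_(i < m) v i].

Lemma power_products1 V : power_products V 0 1.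
Proof. by exists (fun=> 1); split=> [[]|] //; rewrite big_ord0. Qed.

Lemma power_productsM V m m' f g : power_products V m f ->
  power_products V m' g -> power_products V (m + m') (f * g).
Proof.
move=> [v [Vv ->]] [w [Vw ->]].
exists (fun i => match split i with inl j => v j | inr j => w j end); split.
  by move=> i; case: split.
rewrite big_split_ord /=; congr (_ * _); apply: eq_bigr => i _.
  by rewrite (unsplitK (inl _ i)).
by rewrite (unsplitK (inr _ i)).
Qed.

Lemma power_productsX V f q : V f -> power_products V q (f ^+ q).
Proof.
by move=> Vf; exists (fun=> f); split=> //; rewrite prodr_const card_ord.
Qed.

Lemma power_products_prod V (I : Type) (r : seq I) (P : pred I)
    (q : I -> nat) (f : I -> {mpoly k[n]}) :
  (forall i, P i -> power_products V (q i) (f i)) ->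
  power_products V (\sum_(i <- r | P i) q i) (\prod_(i <- r | P i) f i).
Proof.
move=> Vf; elim/big_rec2: _ => [|i m g Pi Vg]; first exact: power_products1.
by apply: power_productsM => //; exact: Vf.
Qed.

End PowerProducts.

Section GelfandKirillov.
Variables (R : realType) (k : fieldType) (n : nat) (S : set {mpoly k[n]}).
Hypothesis hS : monomial_algebra S.
Implicit Types (V : set {mpoly k[n]}).

Local Notation M := (expo S).

Lemma fin_dim_degree_le V : fin_dim V -> V `<=` S ->
  exists c, V `<=` degree_le M c.
Proof.
move=> [d [e eV]] VS; exists (\sum_i msize (tnth e i))%N.
rewrite -(proj2 eV); apply: lin_span_min; first exact: msupported_subspace.
move=> _ /= /tnthP[i ->].
apply: degree_le_monotone (subalg_degree_le hS (VS _ (basis_mem i eV))).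
by rewrite (bigD1 i) //= leq_addr.
Qed.

Definition filtered_span V m : set {mpoly k[n]} :=
  lin_span (\bigcup_(i in [set i | (i <= m)%N]) space_exp V i).

Lemma filtered_span_degree_le V c m : V `<=` degree_le M c ->
  filtered_span V m `<=` degree_le M (c * m).
Proof.
move=> Vc; apply: lin_span_min; first exact: msupported_subspace.
move=> f [i /= im]; apply: lin_span_min f; first exact: msupported_subspace.
move=> f [v [Vv ->]]; apply: (@degree_le_monotone _ _ _ (\sum_(j < i) c)).
  by rewrite sum_nat_const card_ord mulnC leq_mul2l im orbT.
by apply: degree_le_prod => [||j _]; [exact: expo0|exact: expoD|exact: Vc].
Qed.

Lemma GKdim_le_rank : (GKdim R S <= (rank M)%:R%:E)%E.
Proof.
apply: ub_ereal_sup => _ [V [Vfin VS] <-].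
have [c Vc] := fin_dim_degree_le Vfin VS.
apply: (@limn_esup_le_rate _ _ _ ((rank M)%:R * ln c.+1%:R)) => m m1.
apply: ln_growth_le => //; apply: leq_trans (size_low_monomials M (c * m)).
by apply: vdim_msupp_le; exact: filtered_span_degree_le.
Qed.

(** The span of these monomials is the finite-dimensional subspace whose growth attains the
    Gelfand-Kirillov dimension. *)
Definition pivot_monomials : seq 'X_{1..n} :=
  [seq @pivot_fst _ M j | j <- enum (pivot_type M)] ++
  [seq @pivot_snd _ M j | j <- enum (pivot_type M)].

Definition pivot_span : set {mpoly k[n]} := msupported [set` pivot_monomials].

Lemma pivot_span_fst j : pivot_span 'X_[@pivot_fst _ M j].
Proof. by apply/msupportedX; rewrite /= mem_cat map_f ?mem_enum. Qed.

Lemma pivot_span_snd j : pivot_span 'X_[@pivot_snd _ M j].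
Proof. by apply/msupportedX; rewrite /= mem_cat [X in _ || X]map_f ?mem_enum ?orbT. Qed.

Lemma pivot_span_sub : pivot_span `<=` S.
Proof.
move=> f fV; rewrite (monomial_algebraE hS) => m /fV /=; rewrite mem_cat.
by case/orP=> /mapP[j _ ->]; case: (pivot_typeP j).
Qed.

Lemma pivot_comb_products q (c : pivot_type M -> nat) : (forall j, c j <= q)%N ->
  power_products pivot_span (rank M * q) 'X_[pivot_comb q c].
Proof.
move=> cq; rewrite /pivot_comb (big_morph _ (@mpolyXD _ _) (@mpolyX0 _ _)).
rewrite /rank -sum_nat_const; apply: power_products_prod => j _.
rewrite mpolyXD -!mpolyXn -{1}(subnKC (cq j)).
by apply: power_productsM; apply: power_productsX;
  [exact: pivot_span_fst|exact: pivot_span_snd].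
Qed.

(** Each choice of multiplicities between [0] and [q] gives a product of [rank M * q] elements of
    [pivot_span], and different choices give different monomials. *)
Lemma growth_pivot_span q m : (rank M * q <= m)%N ->
  (q.+1 ^ rank M <= growth pivot_span m)%N.
Proof.
move=> qm; have [c Vc] := fin_dim_degree_le (fin_dim_monomials _ _) pivot_span_sub.
pose w (e : {ffun pivot_type M -> 'I_q.+1}) := pivot_comb q (fun j => e j : nat).
have cq (e : {ffun pivot_type M -> 'I_q.+1}) j : (e j <= q)%N.
  by rewrite -ltnS ltn_ord.
have wI : injective w.
  move=> e e' ee'.
  have [|ee _] := @pivot_comb_inj _ M q 0%MM 0%MM _ _ (cq e) (cq e') _
    (congr1 (mnm_add 0%MM) ee'); last by apply/ffunP => j; apply: val_inj; exact: ee.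
  (* In the pivot coordinate the pair takes distinct values [u] and [v], so [u * x + v * (q - x)]
     determines [x] for [x <= q]. *)
  move=> l /addnI; have [_ _ _ uv] := pivot_typeP l.
  move: (cq e l) (cq e' l) uv.
  move: (gcoord _ _) (gcoord _ _) (nat_of_ord _) (nat_of_ord _) => u v x x'.
  nia.
rewrite -card_pivot_fun cardE -(size_map w).
apply: (@le_vdim_monomials _ _ _ _ (low_monomials M (c * m))).
- exact: lin_span_subspace.
- exact: filtered_span_degree_le.
- by rewrite map_inj_uniq ?enum_uniq.
move=> _ /mapP[e _ ->]; apply: sub_lin_span; exists (rank M * q)%N => //.
by apply: sub_lin_span; exact: pivot_comb_products.
Qed.

Lemma rank_le_GKdim : ((rank M)%:R%:E <= GKdim R S)%E.
Proof.
apply: (@le_trans _ _ (limn_esup (fun m =>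
    (ln (growth pivot_span m)%:R / ln (m%:R : R))%:E))); last first.
  apply: ereal_sup_ubound; exists pivot_span => //; split.
    exact: fin_dim_monomials.
  exact: pivot_span_sub.
set r := rank M.
apply: (@limn_esup_ge_rate _ _ _ (r%:R * ln r.+1%:R)) => m m1.
(* Here [q] is [m %/ r.+1], which satisfies [r * q <= m]. Dividing by [r.+1] instead of [r] also
   covers rank [0]. *)
have growth_m : ((m %/ r.+1).+1 ^ r <= growth pivot_span m)%N.
  apply: growth_pivot_span; apply: leq_trans (leq_trunc_div m r.+1).
  by rewrite mulnC leq_mul2l leqnSn orbT.
apply: ln_growth_ge => //; first by apply: leq_trans growth_m; rewrite expn_gt0.
have mr : (m <= r.+1 * (m %/ r.+1).+1)%N by rewrite mulnC; exact/ltnW/ltn_ceil.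
apply: leq_trans (_ : ((r.+1 * (m %/ r.+1).+1) ^ r <= _)%N).
  by case: (posnP r) => [->|r0] //; rewrite leq_exp2r.
by rewrite expnMn leq_mul2l growth_m orbT.
Qed.

End GelfandKirillov.

(** * Poincare series *)

Lemma ler_sum_subset (R : numDomainType) (T : eqType) (F : T -> R) (s s' : seq T) :
  uniq s -> {subset s <= s'} -> (forall x, 0 <= F x) ->
  \sum_(x <- s) F x <= \sum_(x <- s') F x.
Proof.
move=> us ss' F0; elim: s s' us ss' => [|x s IH] s' /= us ss'.
  by rewrite big_nil sumr_ge0.
case/andP: us => xs us; rewrite big_cons [leRHS](big_rem x) /=; last first.
  by apply: ss'; rewrite inE eqxx.
rewrite lerD2l; apply: IH => // y sy; apply: rem_mem.
  by apply: contraNneq xs => <-.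
by apply: ss'; rewrite inE sy orbT.
Qed.

(** Modulo [q] the equation reads [c * dl = c' * dl]. As [dl] is invertible there, [q] divides the
    difference of [c] and [c'], which is smaller than [q]. *)
Lemma coprime_residue_inj q dl x x' c c' : coprime q dl ->
  (c < c' + q)%N -> (c' < c + q)%N -> (x * q + c * dl = x' * q + c' * dl)%N ->
  c = c'.
Proof.
wlog cc' : x x' c c' / (c' <= c)%N => [th|] q_dl cq c'q eqc.
  case: (leqP c' c) => [|/ltnW] le; first exact: (th x x').
  by apply/esym; apply: (th x' x).
have /dvdnP : (q %| (c - c') * dl)%N.
  by apply/dvdnP; exists (x' - x)%N; nia.
have : (q %| (c - c') * dl)%N by apply/dvdnP; exists (x' - x)%N; nia.
rewrite Gauss_dvdl // => /dvdn_leq; lia.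
Qed.

Section PivotGap.
Variables (n : nat) (E : set 'X_{1..n}).

(** One of the two truncated differences vanishes, so their sum is the absolute value of [u - v]. *)
Definition pivot_gap_at (j : pivot_type E) : nat :=
  let u := gcoord (pivot_fst j) (val j) in
  let v := gcoord (pivot_snd j) (val j) in ((u - v) + (v - u))%N.

Definition pivot_gap : nat := (\prod_j pivot_gap_at j)%N.

Lemma pivot_gap_gt0 : (0 < pivot_gap)%N.
Proof.
apply: prodn_gt0 => j; rewrite /pivot_gap_at; have [_ _ _] := pivot_typeP j; lia.
Qed.

(** Modulo [q], the part of a pivot coordinate that comes from its own pair is [c j] times the
    difference [u - v] of the pair, and [a *+ q] vanishes. Invertibility of [u - v] modulo [q] thus
    recovers [c j], one pivot after the other. *)
Lemma pivot_comb_inj_coprime q a a' (c c' : pivot_type E -> nat) :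
  coprime q pivot_gap -> (0 < q)%N ->
  (forall j, c j < q)%N -> (forall j, c' j < q)%N ->
  (a *+ q + pivot_comb q c)%MM = (a' *+ q + pivot_comb q c')%MM ->
  c =1 c' /\ a = a'.
Proof.
move=> q_gap q0 cq c'q /pivot_comb_inj [j|j|j|cc' aa'].
- exact/ltnW/cq.
- exact/ltnW/c'q.
- rewrite !gcoordMn => eq_j.
  have : coprime q (pivot_gap_at j).
    by apply: coprime_dvdr q_gap; rewrite /pivot_gap (bigD1 j) //= dvdn_mulr.
  rewrite /pivot_gap_at; move: (cq j) (c'q j) eq_j.
  move: (gcoord (pivot_fst j) _) (gcoord (pivot_snd j) _) => u v.
  move: (gcoord a _) (gcoord a' _) (c j) (c' j) => x x' y y' yq y'q eq_j.
  (* To stay within natural numbers, [u * y + v * (q - y)] is written as [v * q + y * (u - v)] if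
     [v <= u], and as [u * q + (q - y) * (v - u)] otherwise. *)
  case: (leqP v u) => [vu|/ltnW uv].
    rewrite (eqP vu) addn0 => q_uv.
    by apply: (@coprime_residue_inj q (u - v) (x + v) (x' + v)) => //; nia.
  rewrite (eqP uv) add0n => q_uv.
  apply/eqP; rewrite -(eqn_sub2lE (ltnW yq) (ltnW y'q)); apply/eqP.
  by apply: (@coprime_residue_inj q (v - u) (x + u) (x' + u)) => //; nia.
split=> //; apply/mnmP => l; apply/eqP; rewrite -(eqn_pmul2r q0) -!mulmnE.
by rewrite aa'.
Qed.

End PivotGap.

Section PoincareSeries.
Variables (R : realType) (k : fieldType) (n : nat) (S : set {mpoly k[n]}).
Hypothesis hS : monomial_algebra S.
Local Notation M := (expo S).
Local Notation r := (rank (expo S)).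
Implicit Types t s : R.

Definition monomial_sum D t : R := \sum_(a <- low_monomials M D) t ^+ mdeg a.

Lemma graded_pieceE D j : (j <= D)%N -> graded_piece S j =
  msupported [set` [seq a <- low_monomials M D | mdeg a == j]].
Proof.
move=> jD; rewrite /graded_piece lin_span_monomials; congr msupported.
apply/seteqP; split=> a /=; rewrite mem_filter.
  by case=> aj Sa; rewrite aj eqxx; apply/mem_low_monomials; rewrite aj.
by case/andP=> /eqP aj /mem_low_monomials[].
Qed.

(** Monomials are grouped by degree; the partial sum with [D.+1] terms covers the degrees up to
    [D]. *)
Lemma series_monomial_sum D t :
  pseries (fun j => (vdim (graded_piece S j))%:R) t D.+1 = monomial_sum D t.
Proof.
rewrite /pseries /series /= big_mkord /monomial_sum.
transitivity (\sum_(j < D.+1) \sum_(a <- low_monomials M D | mdeg a == j) t ^+ mdeg a).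
  apply: eq_bigr => j _; have jD : (j <= D)%N by rewrite -ltnS ltn_ord.
  rewrite (graded_pieceE jD) vdim_monomials; last first.
    by rewrite filter_uniq // low_monomials_uniq.
  rewrite (eq_bigr (fun=> t ^+ j)) => [|a /eqP->] //.
  by rewrite -big_filter big_const_seq count_predT iter_addr_0 mulr_natl.
under eq_bigr do rewrite big_mkcond.
rewrite exchange_big /= [LHS]big_seq [RHS]big_seq; apply: eq_bigr => a.
case/mem_low_monomials=> _ aD; rewrite (bigD1 (Ordinal (aD : (mdeg a < D.+1)%N))) //=.
rewrite eqxx big1 ?addr0 // => j ja; case: eqP => // aj; case/negP: ja.
by apply/eqP; apply: val_inj.
Qed.

Lemma monomial_sum_ge0 D t : 0 <= t -> 0 <= monomial_sum D t.
Proof. by move=> t0; apply: sumr_ge0 => a _; exact: exprn_ge0. Qed.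

Lemma monomial_sum_mono D t t' :
  0 <= t -> t <= t' -> monomial_sum D t <= monomial_sum D t'.
Proof.
move=> t0 tt'; apply: ler_sum => a _.
by rewrite lerXn2r // nnegrE (le_trans t0).
Qed.

Lemma geometric_le D s : 0 <= s -> s < 1 ->
  \sum_(c < D) s ^+ c <= (1 - s)^-1.
Proof.
move=> s0 s1; rewrite -[leRHS]mul1r ler_pdivlMr ?subr_gt0 // mulrC.
by rewrite -opprB mulNr -subrX1 opprB gerBl exprn_ge0.
Qed.

(* A monomial of degree [d] has all pivot coordinates at most [d], so each of
   the [r] coordinates may be charged with a factor [s ^ d]. *)
Lemma monomial_sum_le_root D s : 0 <= s -> s < 1 ->
  monomial_sum D (s ^+ r.+1) <= (1 - s)^-1 ^+ r.
Proof.
move=> s0 s1.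
pose phi (a : 'X_{1..n}) : {ffun pivot_type M -> 'I_D.+1} :=
  [ffun j => inord (gcoord a (val j))].
have phiE a j : a \in low_monomials M D -> phi a j = gcoord a (val j) :> nat.
  case/mem_low_monomials=> _ aD; rewrite ffunE inordK // ltnS.
  exact: leq_trans (gcoord_le _ _) aD.
apply: (@le_trans _ _ (\sum_(f : {ffun pivot_type M -> 'I_D.+1}) \prod_j s ^+ f j)).
  apply: (@le_trans _ _ (\sum_(f <- [seq phi a | a <- low_monomials M D])
                            \prod_j s ^+ f j)).
    rewrite big_map /monomial_sum !big_seq; apply: ler_sum => a aD.
    rewrite -exprM prodrXr; apply: ler_wiXn2l => //; first exact: ltW.
    apply: (@leq_trans (r * mdeg a)%N); last by rewrite leq_mul2r leqnSn orbT.
    rewrite /rank -sum_nat_const; apply: leq_sum => j _.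
    by rewrite phiE //; exact: gcoord_le.
  apply: ler_sum_subset => [|f _|f].
  - rewrite map_inj_in_uniq ?low_monomials_uniq // => a b aD bD /ffunP ab.
    have /mem_low_monomials[Ea _] := aD; have /mem_low_monomials[Eb _] := bD.
    apply: (pivot_inj Ea Eb) => i Ti.
    by have := congr1 val (ab (Sub i Ti)); rewrite /= !phiE.
  - by rewrite mem_index_enum.
  - by apply: prodr_ge0 => j _; exact: exprn_ge0.
(* The sum over all functions factors as the [r]-th power of a truncated geometric sum. *)
rewrite -(bigA_distr_bigA (fun (_ : pivot_type M) (c : 'I_D.+1) => s ^+ c)).
rewrite prodr_const; apply: lerXn2r; rewrite ?nnegrE.
- by apply: sumr_ge0 => c _; exact: exprn_ge0.
- by rewrite invr_ge0 subr_ge0 ltW.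
- exact: geometric_le.
Qed.

(** Write [t = s ^+ r.+1]. Then [1 - t <= r.+1%:R * (1 - s)], and the powers of [1 - s] cancel
    against the preceding bound. The exponent [r.+1] makes the root available for [r = 0] too. *)
Lemma monomial_sum_le D t : 0 <= t -> t < 1 ->
  (1 - t) ^+ r * monomial_sum D t <= r.+1%:R ^+ r.
Proof.
move=> t0 t1; have [s [s0 s1 ts]] : exists s, [/\ 0 <= s, s < 1 & t = s ^+ r.+1].
  have [s s0 ts] : exists2 s, 0 <= s & t = s ^+ r.+1.
    exists (t `^ r.+1%:R^-1); first exact: powR_ge0.
    by rewrite -powR_mulrn ?powR_ge0 // -powRrM mulVf ?pnatr_eq0 // powRr1.
  exists s; split=> //; rewrite ltNge; apply/negP => s1.
  by move: t1; rewrite ts ltNge exprn_ege1.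
have s1' : 0 < 1 - s by rewrite subr_gt0.
have tr : 1 - t <= r.+1%:R * (1 - s).
  rewrite ts -opprB subrX1 -mulNr opprB mulrC; apply: (ler_wpM2r (ltW s1')).
  apply: (@le_trans _ _ (\sum_(i < r.+1) (1 : R))).
    by apply: ler_sum => i _; apply: exprn_ile1 => //; exact: ltW.
  by rewrite sumr_const card_ord.
apply: (@le_trans _ _ ((r.+1%:R * (1 - s)) ^+ r * (1 - s)^-1 ^+ r)).
  have t1' : 0 <= 1 - t by rewrite subr_ge0 ltW.
  apply: ler_pM; [exact: exprn_ge0|exact: monomial_sum_ge0| |].
    by rewrite lerXn2r // nnegrE mulr_ge0 // ltW.
  by rewrite {1}ts monomial_sum_le_root.
by rewrite -exprMn mulfK ?gt_eqF.
Qed.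

(** The exponents [a *+ q + pivot_comb q c] are pairwise distinct elements of [M]. For each [a]
    there are [q ^ r] of them, of degree at most [q * mdeg a + pivot_degree M * q], and powers of
    [t < 1] decrease with the degree. *)
Lemma monomial_sum_comb D t q : 0 < t -> t < 1 -> (0 < q)%N ->
  coprime q (pivot_gap M) ->
  q%:R ^+ r * t ^+ (pivot_degree M * q) * monomial_sum D (t ^+ q) <=
  monomial_sum (D * q + pivot_degree M * q) t.
Proof.
move=> t0 t1 q0 q_gap; have t0' := ltW t0; have t1' := ltW t1.
pose comb (a : 'X_{1..n}) (c : {ffun pivot_type M -> 'I_q}) : 'X_{1..n} :=
  (a *+ q + pivot_comb q (fun j => c j : nat))%MM.
have ltcq (c : {ffun pivot_type M -> 'I_q}) j : (c j < q)%N by [].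
have lecq (c : {ffun pivot_type M -> 'I_q}) j : (c j <= q)%N by exact: ltnW.
apply: (@le_trans _ _ (\sum_(b <- [seq comb a c | a <- low_monomials M D,
  c <- enum {ffun pivot_type M -> 'I_q}]) t ^+ mdeg b)); last first.
  apply: ler_sum_subset => [|_ /allpairsP[[a c] /= [aD _ ->]]|b]; last exact: exprn_ge0.
    apply: allpairs_uniq; rewrite ?low_monomials_uniq ?enum_uniq //.
    move=> [a c] [a' c'] _ _ /= /pivot_comb_inj_coprime [] // cc' ->.
    by congr (_, _); apply/ffunP => j; apply: val_inj; exact: cc'.
  have [Ea le_aD] := proj1 (mem_low_monomials _ _ _) aD.
  apply/mem_low_monomials; split.
    apply: expoD => //; first exact: expoMn.
    apply: expo_sum => // j _; have [uE vE _ _] := pivot_typeP j.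
    by apply: expoD => //; exact: expoMn.
  by rewrite mdegD mdegMn leq_add ?leq_mul2r ?le_aD ?orbT // mdeg_pivot_comb.
rewrite big_allpairs_dep /monomial_sum mulr_sumr; apply: ler_sum => a _.
rewrite big_enum /=.
apply: (@le_trans _ _ (\sum_(c : {ffun pivot_type M -> 'I_q})
   t ^+ (pivot_degree M * q) * (t ^+ q) ^+ mdeg a)).
  by rewrite sumr_const card_pivot_fun -[leRHS]mulr_natl natrX mulrA.
apply: ler_sum => c _; rewrite -exprM -exprD ler_wiXn2l //.
rewrite mdegD mdegMn addnC; apply: leq_add; first exact: mdeg_pivot_comb.
by rewrite mulnC.
Qed.

End PoincareSeries.

(** * Self-similar functions *)

(* [q] is the last term of the progression [1 + e * dl] for which [t ^+ q] has
   not yet fallen below [tau]. *)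
Lemma power_window (R : realType) (t tau : R) (dl : nat) :
  0 < tau -> tau <= t -> t < 1 -> (0 < dl)%N ->
  exists e (q := (dl * e).+1), tau <= t ^+ q /\ t ^+ (q + dl) < tau.
Proof.
move=> tau0 taut t1 dl0; have t0 : 0 < t by exact: lt_le_trans taut.
have ex_small : exists e, t ^+ (dl * e.+1).+1 < tau.
  have /cvgrPdist_lt/(_ _ tau0) : (fun e => t ^+ e) @ \oo --> 0.
    by apply: cvg_expr; rewrite gtr0_norm.
  case=> N _ /(_ N (leqnn _)) /=; rewrite sub0r normrN ger0_norm ?exprn_ge0 ?(ltW t0) //.
  move=> tN; exists N; apply: le_lt_trans tN; apply: ler_wiXn2l; [exact: ltW|exact: ltW|].
  by rewrite ltnW // ltnS (leq_trans (leqnSn _)) // leq_pmull.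
case: (ex_minnP ex_small) => e small e_min; exists e => /=; split.
  case: e small e_min => [|e] _ e_min; first by rewrite muln0 expr1.
  by rewrite leNgt; apply/negP => /e_min; rewrite ltnn.
by move: small; rewrite mulnS addSn addnC.
Qed.

Section SelfSimilarLimit.
Variables (R : realType) (P : R -> R) (r C dl : nat) (B : R).
Hypothesis P_ge1 : forall t : R, 0 < t -> t < 1 -> 1 <= P t.
Hypothesis P_mono : forall t t' : R, 0 < t -> t <= t' -> t' < 1 -> P t <= P t'.
Hypothesis P_bound : forall t : R, 0 < t -> t < 1 -> (1 - t) ^+ r * P t <= B.
Hypothesis dl_gt0 : (0 < dl)%N.
Hypothesis P_self : forall (t : R) e (q := (dl * e).+1), 0 < t -> t < 1 ->
  q%:R ^+ r * t ^+ (C * q) * P (t ^+ q) <= P t.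

Let g t := (1 - t) ^+ r * P t.
(** The supremum of this set is the limit of [g] at [1]; the factor [tau ^+ C] is the price of the
    translations and tends to [1]. *)
Let weighted : set R := [set tau ^+ C * g tau | tau in [set tau | 0 < tau < 1]].

(** Choose [q] with [t ^+ (q + dl) < tau <= t ^+ q] and apply self-similarity. Then [P (t ^+ q)] is
    at least [P tau], [t ^+ (C * q)] is at least [tau ^+ C], and [1 - tau / t ^+ dl <= 1 - t ^+ q <=
    q%:R * (1 - t)]. The left-hand side tends to [tau ^+ C * g tau] as [t] tends to [1]. *)
Lemma self_similar_ge t tau : 0 < tau -> tau <= t -> t < 1 -> tau <= t ^+ dl ->
  tau ^+ C * (1 - tau / t ^+ dl) ^+ r * P tau <= g t.
Proof.
move=> tau0 taut t1 tau_tdl; have t0 : 0 < t by exact: lt_le_trans taut.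
have [e [tau_tq tq_tau]] := power_window tau0 taut t1 dl_gt0.
set q := (dl * e).+1 in tau_tq tq_tau.
have tdl0 : 0 < t ^+ dl by exact: exprn_gt0.
have tq1 : t ^+ q < 1 by rewrite exprn_ilt1 // ltW.
have base : 1 - tau / t ^+ dl <= q%:R * (1 - t).
  apply: (@le_trans _ _ (1 - t ^+ q)).
    by rewrite lerD2l lerN2 ler_pdivlMr // -exprD ltW.
  rewrite -opprB subrX1 -mulNr opprB mulrC; apply: ler_wpM2r.
    by rewrite subr_ge0 ltW.
  apply: (@le_trans _ _ (\sum_(i < q) (1 : R))).
    by apply: ler_sum => i _; apply: exprn_ile1; exact: ltW.
  by rewrite sumr_const card_ord.
have base0 : 0 <= 1 - tau / t ^+ dl by rewrite subr_ge0 ler_pdivrMr // mul1r.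
apply: (@le_trans _ _ ((1 - t) ^+ r * (q%:R ^+ r * t ^+ (C * q) * P (t ^+ q)))).
  rewrite !mulrA -exprMn [_ * q%:R]mulrC [(C * q)%N]mulnC exprM [tau ^+ C * _]mulrC.
  have P0 : 0 <= P tau by apply: le_trans ler01 (P_ge1 _ _) => //; exact: le_lt_trans t1.
  apply: ler_pM => //; first by apply: mulr_ge0; apply: exprn_ge0 => //; exact: ltW.
    apply: ler_pM; [exact: exprn_ge0|by apply: exprn_ge0; exact: ltW| |].
      by apply: lerXn2r => //; rewrite nnegrE // (le_trans base0).
    by apply: lerXn2r => //; rewrite nnegrE; apply: ltW => //; exact: exprn_gt0.
  exact: P_mono.
by rewrite /g ler_wpM2l ?exprn_ge0 ?subr_ge0 ?(ltW t1) // P_self.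
Qed.

Lemma weighted_ub : has_ubound weighted.
Proof.
exists B => _ [tau /andP[tau0 tau1] <-].
have g0 : 0 <= g tau.
  apply: mulr_ge0; first by rewrite exprn_ge0 // subr_ge0 ltW.
  exact: le_trans ler01 (P_ge1 _ _).
apply: le_trans (P_bound tau0 tau1); rewrite ler_piMl //.
by apply: exprn_ile1; exact: ltW.
Qed.

Lemma weighted_half : weighted (2^-1 ^+ C * g 2^-1).
Proof. by exists 2^-1 => //=; rewrite invr_gt0 ltr0n /= invf_lt1 // ltr1n. Qed.

Lemma weighted_sup_gt0 : 0 < sup weighted.
Proof.
apply: lt_le_trans (ub_le_sup weighted_ub weighted_half).
have half : (0 : R) < 2^-1 /\ (2^-1 : R) < 1.
  by rewrite invr_gt0 ltr0n invf_lt1 // ltr1n.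
case: half => h0 h1; rewrite mulr_gt0 ?exprn_gt0 // mulr_gt0 ?exprn_gt0 ?subr_gt0 //.
exact: lt_le_trans ltr01 (P_ge1 _ _).
Qed.

Lemma self_similar_cvg : g t @[t --> 1^'-] --> sup weighted.
Proof.
apply/cvgrPdist_lt => e e0; set L := sup weighted.
(* A single [tau] nearly attaining the supremum controls [g] from below near [1]. *)
have [_ [tau /= /andP[tau0 tau1] <-] tauL] : exists2 x, weighted x & L - e < x.
  apply: sup_adherent => //; split; last exact: weighted_ub.
  by exists (2^-1 ^+ C * g 2^-1); exact: weighted_half.
have lo : (tau ^+ C * (1 - tau / t ^+ dl) ^+ r * P tau) @[t --> (1 : R)^'-] -->
          tau ^+ C * g tau.
  have -> : tau ^+ C * g tau = tau ^+ C * (1 - tau / 1 ^+ dl) ^+ r * P tau.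
    by rewrite expr1n divr1 mulrA.
  apply: cvg_at_left_filter; apply: cvgM; last exact: cvg_cst.
  apply: cvgM; first exact: cvg_cst.
  apply: (@cvg_comp _ _ _ (fun t => 1 - tau / t ^+ dl) (fun x => x ^+ r));
    last exact: exprn_continuous.
  apply: cvgB; first exact: cvg_cst.
  apply: cvgM; first exact: cvg_cst.
  by apply: cvgV; [rewrite expr1n oner_neq0|exact: exprn_continuous].
(* Upper bound: [t ^+ C * g t] belongs to [weighted], so [g t <= L / t ^+ C]. *)
have hi : (L / t ^+ C) @[t --> (1 : R)^'-] --> L.
  rewrite -[X in _ --> X](_ : L / 1 ^+ C = L); last by rewrite expr1n divr1.
  apply: cvg_at_left_filter; apply: cvgM; first exact: cvg_cst.
  by apply: cvgV; [rewrite expr1n oner_neq0|exact: exprn_continuous].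
have dl1 : (t ^+ dl) @[t --> (1 : R)^'-] --> (1 : R).
  rewrite -[X in _ --> X](expr1n R dl).
  by apply: cvg_at_left_filter; exact: exprn_continuous.
have lo_near := cvgr_gt _ lo _ tauL.
have hi_near : \forall t \near (1 : R)^'-, L / t ^+ C < L + e.
  by apply: (cvgr_lt L hi); rewrite ltrDl.
have dl_near := cvgr_gt _ dl1 _ tau1.
near=> t.
have t1 : t < 1 by near: t; exact: nbhs_left_lt.
have taut : tau < t by near: t; exact: nbhs_left_gt.
have t0 : 0 < t by exact: lt_trans taut.
rewrite ltr_norml; apply/andP; split.
  rewrite ltrBrDr addrC ltrBlDr.
  apply: (@le_lt_trans _ _ (L / t ^+ C)); last by near: t.
  rewrite ler_pdivlMr ?exprn_gt0 // mulrC; apply: ub_le_sup; first exact: weighted_ub.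
  by exists t => //=; rewrite t0.
rewrite ltrBlDr -ltrBlDl.
apply: (@lt_le_trans _ _ (tau ^+ C * (1 - tau / t ^+ dl) ^+ r * P tau)).
  by near: t; exact: lo_near.
have tau_tdl : tau < t ^+ dl by near: t; exact: dl_near.
exact: self_similar_ge tau0 (ltW taut) t1 (ltW tau_tdl).
Unshelve. all: by end_near. Qed.

End SelfSimilarLimit.

(** * Hilbert-Serre dimension *)

Section HilbertSerre.
Variables (R : realType) (k : fieldType) (n : nat) (S : set {mpoly k[n]}).
Hypothesis hS : monomial_algebra S.
Local Notation M := (expo S).
Local Notation r := (rank (expo S)).
Local Notation P := (@poincare_series k n R S).
Implicit Types t : R.

(** The series has nonnegative terms and bounded partial sums, so its value is their least upper
    bound. Inequalities for [P] thus reduce to finite sums. *)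
Lemma poincare_bounds t : 0 <= t -> t < 1 ->
  (forall D, monomial_sum S D t <= P t) /\
  (forall B, (forall D, monomial_sum S D t <= B) -> P t <= B).
Proof.
move=> t0 t1; set u := pseries (fun j => (vdim (graded_piece S j))%:R) t.
have u_nd : nondecreasing_seq u.
  apply: nondecreasing_series => j _ _.
  by rewrite mulr_ge0 ?exprn_ge0 ?ler0n.
have u_le B : (forall D, monomial_sum S D t <= B) -> forall D, u D <= B.
  (* Passing to [D.+1] covers the empty partial sum [u 0], which is not a [monomial_sum]. *)
  move=> hB D; apply: le_trans (u_nd _ _ (leqnSn D)) _.
  by rewrite /u series_monomial_sum.
have u_cvg : cvgn u.
  apply: nondecreasing_is_cvgn => //.
  exists (r.+1%:R ^+ r / (1 - t) ^+ r) => _ [D _ <-]; apply: u_le => {}D.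
  by rewrite ler_pdivlMr ?exprn_gt0 ?subr_gt0 // mulrC monomial_sum_le.
split=> [D|B /u_le uB].
  rewrite -series_monomial_sum -/u; exact: nondecreasing_cvgn_le.
by apply: limr_le => //; exact: nearW.
Qed.

Lemma poincare_ge1 t : 0 < t -> t < 1 -> 1 <= P t.
Proof.
move=> t0 t1; have [lb _] := poincare_bounds (ltW t0) t1.
apply: le_trans (lb 0%N); rewrite /monomial_sum (big_rem 0%MM) /=; last first.
  by apply/mem_low_monomials; split; [exact: expo0|rewrite mdeg0].
by rewrite mdeg0 expr0 lerDl; apply: sumr_ge0 => a _; rewrite exprn_ge0 // ltW.
Qed.

Lemma poincare_mono t t' : 0 < t -> t <= t' -> t' < 1 -> P t <= P t'.
Proof.
move=> t0 tt' t'1; have [_] := poincare_bounds (ltW t0) (le_lt_trans tt' t'1).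
apply=> D; have [lb _] := poincare_bounds (le_trans (ltW t0) tt') t'1.
by apply: le_trans (lb D); apply: monomial_sum_mono => //; exact: ltW.
Qed.

Lemma poincare_bound t : 0 < t -> t < 1 -> (1 - t) ^+ r * P t <= r.+1%:R ^+ r.
Proof.
move=> t0 t1; have [_ ub] := poincare_bounds (ltW t0) t1.
have t1' : 0 < (1 - t) ^+ r by rewrite exprn_gt0 // subr_gt0.
rewrite mulrC -ler_pdivlMr //; apply: ub => D.
by rewrite ler_pdivlMr // mulrC monomial_sum_le // ltW.
Qed.

(** Such a [q] is [1] modulo [pivot_gap M], hence prime to it. *)
Lemma poincare_self_similar t e (q := (pivot_gap M * e).+1) : 0 < t -> t < 1 ->
  q%:R ^+ r * t ^+ (pivot_degree M * q) * P (t ^+ q) <= P t.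
Proof.
move=> t0 t1; have [lb _] := poincare_bounds (ltW t0) t1.
have tq0 : 0 <= t ^+ q by rewrite exprn_ge0 // ltW.
have tq1 : t ^+ q < 1 by rewrite exprn_ilt1 // ltW.
have [_ ub] := poincare_bounds tq0 tq1.
have c0 : 0 < q%:R ^+ r * t ^+ (pivot_degree M * q).
  by rewrite mulr_gt0 ?exprn_gt0 ?ltr0n.
rewrite mulrC -ler_pdivlMr //; apply: ub => D; rewrite ler_pdivlMr // mulrC.
apply: le_trans (lb (D * q + pivot_degree M * q)%N).
apply: monomial_sum_comb => //.
apply: coprime_dvdr (dvdn_mulr e (dvdnn _)) _; exact: coprimeSn.
Qed.

Lemma poincare_cvg : exists2 L : R, 0 < L &
  ((1 - t) ^+ r * P t) @[t --> (1 : R)^'-] --> L.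
Proof.
eexists; last first.
  exact: (self_similar_cvg poincare_ge1 poincare_mono poincare_bound
    (pivot_gap_gt0 M) poincare_self_similar).
exact: (weighted_sup_gt0 _ poincare_ge1 poincare_bound).
Qed.

Lemma hilbert_serre_rank : hilbert_serre_dim R S = r%:R%:E.
Proof.
have [L L0 PL] := poincare_cvg.
apply/eqP; rewrite eq_le; apply/andP; split.
  by apply: ereal_inf_lbound; exists r => //; apply: cvgP PL.
apply: le_ereal_inf_tmp => _ [d /= d_cvg <-]; rewrite lee_fin ler_nat leqNgt.
apply/negP => dr; move: L0; suff -> : L = 0 by rewrite ltxx.
(* If the limit existed for some [d < r], the extra factor [(1 - t) ^+ (r - d)] would force the
   limit for [r] to be [0], although it is positive. *)
have vanish : ((1 - t) ^+ (r - d)) @[t --> (1 : R)^'-] --> (0 : R).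
  rewrite -[X in _ --> X](_ : (1 - 1 : R) ^+ (r - d) = 0); last first.
    by rewrite subrr expr0n subn_eq0 leqNgt dr.
  apply: cvg_at_left_filter.
  apply: (@cvg_comp _ _ _ (fun t => 1 - t) (fun x => x ^+ (r - d)));
    last exact: exprn_continuous.
  by apply: cvgB; [exact: cvg_cst|exact: cvg_id].
have cvg0 : ((1 - t) ^+ r * P t) @[t --> (1 : R)^'-] --> (0 : R).
  rewrite -(mul0r (lim (((1 - t) ^+ d * P t) @[t --> (1 : R)^'-]))).
  rewrite (_ : (fun t => (1 - t) ^+ r * P t) =
      (fun t => (1 - t) ^+ (r - d) * ((1 - t) ^+ d * P t))).
    exact: cvgM vanish d_cvg.
  by apply/funext => t; rewrite mulrA -exprD subnK // ltnW.
by rewrite -(cvg_lim (@Rhausdorff R) PL) (cvg_lim (@Rhausdorff R) cvg0).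
Qed.

End HilbertSerre.

Theorem theorem1p3 (R : realType) (k : fieldType) (n : nat)
    (S : set {mpoly k[n]}) (hS : monomial_algebra S) :
  gr_krull_dim R S = krull_dim R S /\
  krull_dim R S = trdeg R S /\
  trdeg R S = GKdim R S /\
  GKdim R S = hilbert_serre_dim R S.
Proof.
(* The next four inequalities close a cycle through the rank, the graded and ungraded Krull
   dimensions and the transcendence degree. *)
have rank_gr := rank_le_gr_krull R hS.
have gr_krull := gr_krull_le_krull R S.
have krull_tr := krull_le_trdeg R hS.
have tr_rank := trdeg_le_rank R hS.
have tr_gr := le_trans tr_rank rank_gr.
have GK_rank : GKdim R S = (rank (expo S))%:R%:E.
  by apply/le_anti; rewrite GKdim_le_rank ?rank_le_GKdim.
split; last split; last split.
- by apply/le_anti; rewrite gr_krull (le_trans krull_tr).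
- by apply/le_anti; rewrite krull_tr (le_trans tr_gr).
- apply/le_anti; rewrite GK_rank tr_rank.
  by rewrite (le_trans rank_gr) // (le_trans gr_krull).
- by rewrite GK_rank hilbert_serre_rank.
Qed.
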